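(* Let $\{\Phi_t\}_{t\ge 0}$ be a primitive quantum Markov semigroup on $M_n(\mathbb{C})$ with generator $\mathcal{L}$ that is KMS-symmetric with respect to its faithful invariant state $\rho$. Let $W_1,\dots,W_m\in M_n(\mathbb{C})$ be an indexed family, invariant under taking adjoints (there is a permutation $\sigma$ of $\{1,\dots,m\}$ with $W_j^*=W_{\sigma(j)}$ for all $j$), such that for all $X,Y\in M_n(\mathbb{C})$ $$\langle X,\mathcal{L}(Y)\rangle_{\mathrm{KMS},\rho}=\sum_{j=1}^m\langle[W_j,X],[W_j,Y]\rangle_{\mathrm{KMS},\rho}.$$ Then $d_{\Gamma_0}(D_1,D_2)\le d_{\mathcal{L}}(D_1,D_2)$ for all density matrices $D_1,D_2\in M_n(\mathbb{C})$, and $$\mathrm{diam}_{d_{\Gamma_0}}\mathcal{S}(M_n(\mathbb{C}))\;\le\;\mathrm{diam}_{d_{\mathcal{L}}}\mathcal{S}(M_n(\mathbb{C}))\;\le\;\frac{2s_+}{s_-\,h_\rho(\mathcal{L})}\sqrt{\frac{\|\mathcal{L}\|_{\mathrm{KMS},\rho}}{s_-}}.$$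
   Context: Throughout $n\ge 2$ and $M_n(\mathbb{C})$ carries the unnormalized trace $\mathrm{Tr}$. A quantum Markov semigroup is a norm-continuous semigroup $\{\Phi_t\}_{t\ge0}$ of unital completely positive linear maps on $M_n(\mathbb{C})$ with $\Phi_0=\mathrm{Id}$; its generator $\mathcal{L}$ is defined by $\Phi_t=e^{-t\mathcal{L}}$. A faithful state $\rho$ has positive definite density matrix $D_\rho$, $\rho(X)=\mathrm{Tr}(D_\rho X)$; $s_-$ and $s_+$ are the smallest and largest eigenvalues of $D_\rho$. The KMS inner product is $\langle X,Y\rangle_{\mathrm{KMS},\rho}=\mathrm{Tr}(X^*D_\rho^{1/2}YD_\rho^{1/2})$, with norm $\|X\|_{\mathrm{KMS},\rho}$; for a linear map, $\|\mathcal{L}\|_{\mathrm{KMS},\rho}=\sup_{X\ne0}\|\mathcal{L}(X)\|_{\mathrm{KMS},\rho}/\|X\|_{\mathrm{KMS},\rho}$. The semigroup is KMS-symmetric with respect to $\rho$ if $\langle X,\Phi_t(Y)\rangle_{\mathrm{KMS},\rho}=\langle \Phi_t(X),Y\rangle_{\mathrm{KMS},\rho}$ for all $t\ge0$ and all $X,Y$. It is primitive if it admits a faithful invariant state and $\ker\mathcal{L}=\mathbb{C}I$; $\rho$ is then the unique invariant state. Projection Dirichlet conductance: $h_\rho(\mathcal{L})=\inf_{P}\dfrac{\langle P,\mathcal{L}(P)\rangle_{\mathrm{KMS},\rho}}{\min\{\rho(P),1-\rho(P)\}}$, the infimum over all orthogonal projections $P\in M_n(\mathbb{C})$ with $P\ne0,I$.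 $\mathcal{S}(M_n(\mathbb{C}))$ is the set of density matrices (positive semidefinite, trace one). Distances on it: $d_{\mathcal{L}}(D_1,D_2)=\sup\{|\mathrm{Tr}((D_1-D_2)X)|:\ X=X^*,\ \langle X,\mathcal{L}(X)\rangle_{\mathrm{KMS},\rho}\le1\}$ and Connes' distance $d_{\Gamma_0}(D_1,D_2)=\sup\{|\mathrm{Tr}((D_1-D_2)X)|:\ X=X^*,\ \|\Gamma_0(X)\|\le1\}$, where $\Gamma_0(X)=\sum_{j=1}^m[W_j,X]^*[W_j,X]$ and $\|\cdot\|$ is the operator norm. For a distance $d$, $\mathrm{diam}_d\,\mathcal{S}(M_n(\mathbb{C}))=\sup_{D_1,D_2}d(D_1,D_2)$. (A family $W_1,\dots,W_m$ as in the claim always exists for KMS-symmetric quantum Markov semigroups on $M_n(\mathbb{C})$.) *)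

(* Defs.v *)
(* The complex numbers are R[i] for R : realType. *)
From HB Require Import structures.
From mathcomp Require Import all_boot all_order all_algebra.
From mathcomp Require Import perm complex.
From mathcomp Require Import all_classical all_reals all_analysis.

Set Implicit Arguments.
Unset Strict Implicit.
Unset Printing Implicit Defensive.

Import Order.TTheory GRing.Theory Num.Theory.
Import numFieldNormedType.Exports.

Local Open Scope classical_set_scope.
Local Open Scope ring_scope.
Local Open Scope complex_scope.
Local Open Scope sesquilinear_scope.

(* The real-valued modulus: the generic `|z| is itself an element of R[i]. *)
Definition cmod (R : realType) (z : R[i]) : R := complex.Re `|z|.

(* A <= B on R[i] compares real parts and forces equal imaginary parts, so
   the condition below says that v^* A v is real and nonnegative for every v;
   over the complex numbers this includes A^* = A. *)
Definition psdmx (R : realType) (n : nat) (A : 'M[R[i]]_n) : Prop :=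
  forall v : 'cV[R[i]]_n, 0 <= \tr (v ^t* *m A *m v).

Definition posdefmx (R : realType) (n : nat) (A : 'M[R[i]]_n) : Prop :=
  forall v : 'cV[R[i]]_n, v != 0 -> 0 < \tr (v ^t* *m A *m v).

(* Square root by functional calculus: for a normal matrix
   A = U^-1 diag(d) U with U = spectralmx A unitary and d = spectral_diag A. *)
Definition sqrtmx (R : realType) (n : nat) (A : 'M[R[i]]_n) : 'M[R[i]]_n :=
  invmx (spectralmx A) *m diag_mx (map_mx sqrtC (spectral_diag A))
    *m spectralmx A.

Definition density (R : realType) (n : nat) (D : 'M[R[i]]_n) : Prop :=
  psdmx D /\ \tr D = 1.

Definition faithful_density (R : realType) (n : nat) (D : 'M[R[i]]_n) : Prop :=
  posdefmx D /\ \tr D = 1.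

Definition state (R : realType) (n : nat) (D X : 'M[R[i]]_n) : R[i] :=
  \tr (D *m X).

(* The spectrum of a Hermitian matrix of positive size is a nonempty finite
   set of real numbers, so the infimum and supremum are attained. *)
Definition smallest_eigenvalue (R : realType) (n : nat) (D : 'M[R[i]]_n) : R :=
  inf [set x : R | eigenvalue D x%:C].

Definition largest_eigenvalue (R : realType) (n : nat) (D : 'M[R[i]]_n) : R :=
  sup [set x : R | eigenvalue D x%:C].

Definition vnorm (R : realType) (n : nat) (v : 'cV[R[i]]_n) : R :=
  Num.sqrt (\sum_(i < n) cmod (v i 0) ^+ 2).

(* Operator norm. *)
Definition opnorm (R : realType) (n : nat) (A : 'M[R[i]]_n) : R :=
  sup [set vnorm (A *m v) | v in [set v : 'cV[R[i]]_n | vnorm v <= 1]].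

(* Norm of a linear map on (M_n(C), opnorm); it is only applied to linear
   maps, for which the set is bounded. *)
Definition mapnorm (R : realType) (n : nat)
    (F : 'M[R[i]]_n -> 'M[R[i]]_n) : R :=
  sup [set opnorm (F X) | X in [set X : 'M[R[i]]_n | opnorm X <= 1]].

(* Complete positivity: for every k, the map acting blockwise on k x k block
   matrices with blocks in M_n(C) preserves positive semidefiniteness. *)
Definition completely_positive (R : realType) (n : nat)
    (F : 'M[R[i]]_n -> 'M[R[i]]_n) : Prop :=
  forall (k : nat) (A : 'I_k -> 'I_k -> 'M[R[i]]_n),
    psdmx (\mxblock_(i < k, j < k) A i j) ->
    psdmx (\mxblock_(i < k, j < k) F (A i j)).

(* The values Phi t for t < 0 are irrelevant. *)
Record quantum_markov_semigroup (R : realType) (n : nat)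
    (Phi : R -> 'M[R[i]]_n -> 'M[R[i]]_n) : Prop := {
  qms_linear : forall t : R, 0 <= t -> linear (Phi t);
  qms_unital : forall t : R, 0 <= t -> Phi t 1%:M = 1%:M;
  qms_cp : forall t : R, 0 <= t -> completely_positive (Phi t);
  qms_0 : forall X, Phi 0 X = X;
  qms_add : forall s t : R, 0 <= s -> 0 <= t ->
    forall X, Phi (s + t) X = Phi s (Phi t X);
  qms_continuous : forall t : R, 0 <= t ->
    mapnorm (fun X => Phi s X - Phi t X)
      @[s --> within [set s : R | 0 <= s] (nbhs t)] --> (0 : R)
}.

(* Phi t = exp(- t L) for t >= 0, the exponential series converging in norm. *)
Definition generates (R : realType) (n : nat)
    (L : {linear 'M[R[i]]_n -> 'M[R[i]]_n})
    (Phi : R -> 'M[R[i]]_n -> 'M[R[i]]_n) : Prop :=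
  forall t : R, 0 <= t ->
    mapnorm (fun X => Phi t X
        - \sum_(k < N) ((- t) ^+ k / k`!%:R)%:C *: iter k L X)
      @[N --> \oo] --> (0 : R).

Definition kms (R : realType) (n : nat) (D X Y : 'M[R[i]]_n) : R[i] :=
  \tr (X ^t* *m sqrtmx D *m Y *m sqrtmx D).

Definition kms_norm (R : realType) (n : nat) (D X : 'M[R[i]]_n) : R :=
  Num.sqrt (complex.Re (kms D X X)).

Definition kms_mapnorm (R : realType) (n : nat) (D : 'M[R[i]]_n)
    (F : 'M[R[i]]_n -> 'M[R[i]]_n) : R :=
  sup [set kms_norm D (F X) / kms_norm D X
      | X in [set X : 'M[R[i]]_n | X != 0]].

Definition kms_symmetric (R : realType) (n : nat) (D : 'M[R[i]]_n)
    (Phi : R -> 'M[R[i]]_n -> 'M[R[i]]_n) : Prop :=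
  forall t : R, 0 <= t -> forall X Y, kms D X (Phi t Y) = kms D (Phi t X) Y.

Definition invariant_state (R : realType) (n : nat) (D : 'M[R[i]]_n)
    (Phi : R -> 'M[R[i]]_n -> 'M[R[i]]_n) : Prop :=
  forall t : R, 0 <= t -> forall X, state D (Phi t X) = state D X.

Definition primitive (R : realType) (n : nat)
    (Phi : R -> 'M[R[i]]_n -> 'M[R[i]]_n)
    (L : {linear 'M[R[i]]_n -> 'M[R[i]]_n}) : Prop :=
  (exists D, faithful_density D /\ invariant_state D Phi) /\
  (forall X, L X = 0 <-> exists c : R[i], X = c%:M).

Definition projection (R : realType) (n : nat) (P : 'M[R[i]]_n) : Prop :=
  P ^t* = P /\ P *m P = P.

(* Real parts only convert the type: rho(P) is real, and so is <X, L X> when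
   L generates a KMS-symmetric semigroup. *)
Definition conductance (R : realType) (n : nat) (D : 'M[R[i]]_n)
    (L : {linear 'M[R[i]]_n -> 'M[R[i]]_n}) : R :=
  inf [set complex.Re (kms D P (L P)) /
           Num.min (complex.Re (state D P)) (1 - complex.Re (state D P))
      | P in [set P : 'M[R[i]]_n | projection P /\ P != 0 /\ P != 1%:M]].

Definition commutator (R : realType) (n : nat) (A B : 'M[R[i]]_n) :
    'M[R[i]]_n :=
  A *m B - B *m A.

Definition Gamma0 (R : realType) (n m : nat) (W : 'I_m -> 'M[R[i]]_n)
    (X : 'M[R[i]]_n) : 'M[R[i]]_n :=
  \sum_(j < m) (commutator (W j) X) ^t* *m commutator (W j) X.

(* Distances and diameters take values in the extended reals, so that a
   supremum is meaningful whether or not the set is bounded. *)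
Definition dist_L (R : realType) (n : nat) (D : 'M[R[i]]_n)
    (L : {linear 'M[R[i]]_n -> 'M[R[i]]_n}) (D1 D2 : 'M[R[i]]_n) : \bar R :=
  ereal_sup [set (cmod (\tr ((D1 - D2) *m X)))%:E
            | X in [set X : 'M[R[i]]_n | X ^t* = X /\
                                      complex.Re (kms D X (L X)) <= 1]].

Definition dist_Gamma0 (R : realType) (n m : nat) (W : 'I_m -> 'M[R[i]]_n)
    (D1 D2 : 'M[R[i]]_n) : \bar R :=
  ereal_sup [set (cmod (\tr ((D1 - D2) *m X)))%:E
            | X in [set X : 'M[R[i]]_n | X ^t* = X /\ opnorm (Gamma0 W X) <= 1]].

Definition diam (R : realType) (n : nat)
    (d : 'M[R[i]]_n -> 'M[R[i]]_n -> \bar R) : \bar R :=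
  ereal_sup [set d D1 D2 | D1 in @density R n & D2 in @density R n].

(* Main.v *)
Require Import Defs.
From HB Require Import structures.
From mathcomp Require Import all_boot all_order all_algebra.
From mathcomp Require Import perm complex.
From mathcomp Require Import all_classical all_reals all_analysis.
From mathcomp Require Import ring lra.

(* Write s, t for the extreme eigenvalues of D, so that the KMS norm lies
   between sqrt(s) and sqrt(t) times the Hilbert-Schmidt norm. In an eigenbasis
   of a Hermitian X with eigenvalues x_a and eigenprojections P_a,
     sum_j |[W_j, X]|_HS^2 = sum_(a,b) q_ab (x_a - x_b)^2,
   the energy of x on a weighted graph. Give the vertex a the mass
   mu_a = rho(P_a) >= s. Testing the conductance on spectral projections of X
   shows that every cut of the graph weighs at least h/t times the smaller
   mass, and |P|_KMS^2 <= rho(P) shows that the degree of a is at most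
   (|L|/s) mu_a. Cheeger's inequality for this graph, with the masses mu rather
   than the counting measure, bounds sum_a mu_a (x_a - c)^2 by
   2 (|L|/s) (t/h)^2 times the energy for a weighted median c. Since
   mu_a >= s, this controls max x - min x, which dominates |Tr((D1 - D2) X)|.

   The constant is a quotient by h, so h > 0 is needed: as ker L is the line of
   scalar matrices, <X, L X> >= k |X - c|_HS^2 for some k > 0 and scalar c
   depending on X, and a projection other than 0 and 1 stays at squared
   distance at least 1/2 from all scalars.

   For the comparison with Connes' distance,
   2 |A|_KMS^2 <= rho(A A^* ) + rho(A^* A) is summed over A = [W_j, X]. *)

Set Implicit Arguments.
Unset Strict Implicit.
Unset Printing Implicit Defensive.

Import Order.TTheory GRing.Theory Num.Theory.
Import numFieldNormedType.Exports.

Local Open Scope ring_scope.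

(** * Cheeger's inequality on a weighted graph *)

(** The sum runs over ordered pairs, so on the indicator of a set it is the total weight of the cut,
    counted in both directions. *)
Definition graph_energy (R : realFieldType) (I : finType) (q : I -> I -> R)
    (f : I -> R) : R :=
  \sum_a \sum_b q a b * (f a - f b) ^+ 2.

(** Layer-cake argument by induction on the size of the support [A] of [F]. Subtracting the least
    positive value [c] on [A] splits both sides into [c] times their value for the indicator of [A],
    handled by the cut hypothesis, plus their value for [F']. As [F' <= F], the cut hypothesis
    passes to [F']. *)
Lemma coarea_bound (R : realFieldType) (I : finType) (q : I -> I -> R)
    (mu : I -> R) (h : R) (F : I -> R) :
  (forall a b, 0 <= q a b) -> (forall a, 0 <= F a) ->
  (forall A : {set I}, (forall a, a \in A -> 0 < F a) ->
     h * \sum_(a in A) mu a <= graph_energy q (fun a => (a \in A)%:R)) ->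
  h * \sum_a mu a * F a <= \sum_a \sum_b q a b * `|F a - F b|.
Proof.
move=> q_ge0.
have [n] := ubnP #|[set a | 0 < F a]|.
elim: n F => // n IHn F; rewrite ltnS => suppF F_ge0 cutF.
set A := [set a | 0 < F a] in suppF.
have FA0 a : a \notin A -> F a = 0.
  by rewrite inE -leNgt => Fa; apply/eqP; rewrite eq_le Fa F_ge0.
have [A0|[a0 a0A]] := set_0Vmem A.
  rewrite big1 ?mulr0 => [|a _]; last by rewrite FA0 ?mulr0 // A0 inE.
  by apply: sumr_ge0 => a _; apply: sumr_ge0 => b _; rewrite mulr_ge0.
have [a1 a1A Fmin] : exists2 a1, a1 \in A & forall a, a \in A -> F a1 <= F a.
  by case: (arg_minP F a0A) => a1 a1A Fa1; exists a1.
set c := F a1 in Fmin; have c_gt0 : 0 < c by rewrite inE in a1A.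
pose F' a := F a - c * (a \in A)%:R.
have F'_ge0 a : 0 <= F' a.
  rewrite /F'; case: (boolP (a \in A)) => aA; first by rewrite mulr1 subr_ge0 Fmin.
  by rewrite mulr0 subr0.
have F'F a : F' a <= F a by rewrite lerBlDr lerDl mulr_ge0 // ltW.
have := IHn F' _ F'_ge0 _.
have cardF' : (#|[set a | (0 < F' a)%R]| < n)%N.
  apply: leq_trans suppF; apply: proper_card; apply/properP; split.
    by apply/fintype.subsetP => a; rewrite !inE => /lt_le_trans; apply.
  by exists a1 => //; rewrite inE /F' a1A mulr1 subrr ltxx.
move=> /(_ cardF') IH.
have {}IH := IH (fun B BF => cutF B (fun a aB => lt_le_trans (BF a aB) (F'F a))).
have cutA : h * \sum_(a in A) mu a <= graph_energy q (fun a => (a \in A)%:R).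
  by apply: cutF => a; rewrite inE.
have -> : \sum_a mu a * F a = c * \sum_(a in A) mu a + \sum_a mu a * F' a.
  rewrite [X in c * X]big_mkcond mulr_sumr -big_split; apply: eq_bigr => a _ /=.
  by rewrite /F'; case: ifP => _ /=; ring.
(* An edge inside [A] or outside [A] keeps its difference; an edge leaving [A] loses exactly [c],
   because [F] vanishes outside [A]. *)
have -> : \sum_a \sum_b q a b * `|F a - F b| =
    c * graph_energy q (fun a => (a \in A)%:R)
    + \sum_a \sum_b q a b * `|F' a - F' b|.
  rewrite mulr_sumr -big_split; apply: eq_bigr => a _ /=.
  rewrite mulr_sumr -big_split; apply: eq_bigr => b _ /=.
  rewrite mulrCA -mulrDr; congr (_ * _).
  have /(_ a) FF' := F'_ge0; have /(_ b) FF'b := F'_ge0; move: FF' FF'b.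
  rewrite /F'; case: (boolP (a \in A)) => aA; case: (boolP (b \in A)) => bA /=.
  - by move=> _ _; rewrite subrr expr0n mulr0 add0r !mulr1; congr `|_|; ring.
  - rewrite (FA0 _ bA) => Fa _; rewrite !mulr0 !subr0 !mulr1 expr1n.
    by rewrite !ger0_norm //; [ring | lra].
  - rewrite (FA0 _ aA) => _ Fb.
    rewrite !mulr0 !sub0r ?oppr0 ?sub0r !mulr1 sqrrN expr1n !normrN.
    by rewrite !ger0_norm //; [ring | lra].
  - by rewrite !FA0 // !(mulr0, subr0) expr0n mulr0 add0r.
rewrite mulrDr mulrCA lerD // ler_wpM2l //; exact: ltW.
Qed.

Section Cheeger.
Context (R : realFieldType) (I : finType) (q : I -> I -> R) (mu : I -> R).
Context (h K : R).
Context (q_ge0 : forall a b, 0 <= q a b).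
Context (mu_ge0 : forall a, 0 <= mu a).
Context (h_gt0 : 0 < h).
Context (K_gt0 : 0 < K).
Context (deg_le : forall a,
  graph_energy q (fun b => (b \in [set a])%:R) <= K * mu a).

(** The energy of the indicator of [a] is the weight of the edges leaving or entering [a]. Loops are
    left out because this energy does not see [q a a], so [deg_le] gives no control of it. *)
Lemma degree_energy (f : I -> R) :
  \sum_a \sum_(b | b != a) q a b * (f a ^+ 2 + f b ^+ 2) =
  \sum_a f a ^+ 2 * graph_energy q (fun b => (b \in [set a])%:R).
Proof.
have degE c : graph_energy q (fun b => (b \in [set c])%:R) =
    \sum_(b | b != c) q c b + \sum_(b | b != c) q b c.
  rewrite /graph_energy (bigD1 c) //=; congr (_ + _).
    rewrite (bigD1 c) //= subrr expr0n mulr0 add0r; apply: eq_bigr => b bc.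
    by rewrite !inE eqxx (negPf bc) subr0 expr1n mulr1.
  apply: eq_bigr => a ac; rewrite (bigD1 c) //= big1 ?addr0 => [|b bc].
    by rewrite !inE (negPf ac) eqxx sub0r sqrrN expr1n mulr1.
  by rewrite !inE (negPf ac) (negPf bc) subrr expr0n mulr0.
under [RHS]eq_bigr => a _ do rewrite degE mulrDr !mulr_sumr.
rewrite (eq_bigr (fun a => \sum_(b | b != a) q a b * f a ^+ 2
    + \sum_(b | b != a) q a b * f b ^+ 2)); last first.
  by move=> a _; rewrite -big_split; apply: eq_bigr => b _; rewrite mulrDr.
rewrite !big_split; congr (_ + _) => /=.
  by apply: eq_bigr => a _; apply: eq_bigr => b _; rewrite mulrC.
rewrite (exchange_big_dep predT) //=; apply: eq_bigr => a _.
by apply: eq_big => [b|b _]; rewrite 1?eq_sym 1?mulrC.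
Qed.

(* [2 |u v| <= t u^2 + v^2 / t] with [t = 2 K / h]. *)
Lemma cheeger_half (f : I -> R) :
  (forall a, 0 <= f a) ->
  (forall A : {set I}, (forall a, a \in A -> 0 < f a) ->
     h * \sum_(a in A) mu a <= graph_energy q (fun a => (a \in A)%:R)) ->
  h ^+ 2 * \sum_a mu a * f a ^+ 2 <= 2 * K * graph_energy q f.
Proof.
move=> f_ge0 cutf.
(* The layer-cake bound is applied to the square of [f], whose differences factor as
   [(f a - f b) * (f a + f b)]. *)
have := @coarea_bound _ _ q mu h (fun a => f a ^+ 2) q_ge0.
move=> /(_ (fun a => sqr_ge0 _)) coarea.
have {}coarea : h * \sum_a mu a * f a ^+ 2 <=
    \sum_a \sum_b q a b * `|f a ^+ 2 - f b ^+ 2|.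
  apply: coarea => A fA; apply: cutf => a /fA.
  by rewrite !lt_def f_ge0 sqrf_eq0 sqr_ge0.
set S := \sum_a mu a * f a ^+ 2 in coarea *.
have deg : \sum_a \sum_(b | b != a) q a b * (f a + f b) ^+ 2 <= 2 * K * S.
  apply: (@le_trans _ _ (2 * \sum_a \sum_(b | b != a)
      q a b * (f a ^+ 2 + f b ^+ 2))).
    rewrite mulr_sumr; apply: ler_sum => a _; rewrite mulr_sumr.
    apply: ler_sum => b _; rewrite [X in _ <= X]mulrCA ler_wpM2l //.
    by have := sqr_ge0 (f a - f b); lra.
  rewrite degree_energy -mulrA ler_wpM2l ?ler0n // mulr_sumr.
  by apply: ler_sum => a _; have := ler_wpM2l (sqr_ge0 (f a)) (deg_le a); lra.
(* The weight [h / (4 * K)] is chosen so that, by [deg], the last term is at most [h / 2 * S]: half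
   of the left side of [coarea], where it is absorbed. *)
have split2 : \sum_a \sum_b q a b * `|f a ^+ 2 - f b ^+ 2| <=
   (K / h) * graph_energy q f
   + h / (4 * K) * \sum_a \sum_(b | b != a) q a b * (f a + f b) ^+ 2.
  rewrite !mulr_sumr -big_split; apply: ler_sum => a _ /=.
  rewrite (bigD1 a) //= subrr normr0 mulr0 add0r.
  rewrite [X in _ <= _ * X + _](bigD1 a) //= subrr expr0n mulr0 add0r.
  rewrite !mulr_sumr -big_split; apply: ler_sum => b ab /=.
  rewrite mulrCA [X in _ <= _ + X]mulrCA -mulrDr ler_wpM2l //.
  rewrite subr_sqr normrM (ger0_norm (addr_ge0 (f_ge0 a) (f_ge0 b))).
  rewrite -(real_normK (num_real (f a - f b))).
  set u := `|_|; set v := f a + f b.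
  have := sqr_ge0 (2 * K * u - h * v).
  have hK : 0 < 4 * K * h by rewrite !mulr_gt0.
  move=> sq; rewrite -subr_ge0.
  rewrite -(pmulr_rge0 _ hK).
  suff -> : 4 * K * h * (K / h * u ^+ 2 + h / (4 * K) * v ^+ 2 - u * v) =
    (2 * K * u - h * v) ^+ 2 by [].
  by field; rewrite !gt_eqF.
have {}deg : h / (4 * K) * \sum_a \sum_(b | b != a) q a b * (f a + f b) ^+ 2
   <= h / 2 * S.
  apply: le_trans (ler_wpM2l _ deg) _; first by rewrite divr_ge0 ?mulr_ge0 ?ltW.
  by rewrite le_eqVlt; apply/orP; left; apply/eqP; field; rewrite gt_eqF.
have le1 : h / 2 * S <= K / h * graph_energy q f by lra.
have -> : h ^+ 2 * S = 2 * h * (h / 2 * S) by field.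
have -> : 2 * K * graph_energy q f = 2 * h * (K / h * graph_energy q f).
  by field; rewrite gt_eqF.
by rewrite ler_pM2l // mulr_gt0.
Qed.

Context (cut_ge : forall A : {set I},
  h * Num.min (\sum_(a in A) mu a) (\sum_(a in ~: A) mu a) <=
  graph_energy q (fun a => (a \in A)%:R)).

(** The median is the least value [x a1] with at most half of the mass strictly above it. If [x b1]
    is the next smaller value, minimality puts more than half of the mass above [x b1], and what
    remains is exactly the mass below [x a1]. *)
Lemma weighted_median (x : I -> R) (a0 : I) : exists m,
  \sum_(a | m < x a) mu a <= (\sum_a mu a) / 2 /\
  \sum_(a | x a < m) mu a <= (\sum_a mu a) / 2.
Proof.
set M := \sum_a mu a.
have M_ge0 : 0 <= M by apply: sumr_ge0.
pose P a := \sum_(b | x a < x b) mu b <= M / 2.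
have [a1 Pa1] : exists a1, P a1.
  case: (@arg_maxP _ _ _ a0 xpredT x isT) => a1 _ max_a1; exists a1.
  rewrite /P big_pred0 ?divr_ge0 // => b.
  by apply/negbTE; rewrite -leNgt; apply: max_a1.
case: (arg_minP x Pa1) => {}a1 {}Pa1 min_a1; exists (x a1); split => //.
pose Q b := x b < x a1.
case: (pickP Q) => [b0 Qb0|Q0]; last by rewrite big_pred0 ?divr_ge0.
case: (arg_maxP x Qb0) => b1 Qb1 max_b1.
have NP : M / 2 < \sum_(b | x b1 < x b) mu b.
  by rewrite ltNge; apply/negP => /min_a1; rewrite leNgt (Qb1 : is_true (x b1 < x a1)).
have E : M = \sum_(b | x b1 < x b) mu b + \sum_(b | x b < x a1) mu b.
  rewrite /M (bigID (fun b => x b1 < x b)) /=; congr (_ + _).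
  apply: eq_bigl => b; rewrite -leNgt; apply/idP/idP => [bb1|/max_b1 //].
  exact: le_lt_trans bb1 Qb1.
by lra.
Qed.

(** The positive parts [f] of [x - m] and [g] of [m - x] live on sets carrying at most half of the
    mass, where the minimum in [cut_ge] is the mass of the set itself. [cheeger_half] applies to
    each, and the two estimates are added. *)
Theorem cheeger_inequality (x : I -> R) (a0 : I) : exists m,
  h ^+ 2 * \sum_a mu a * (x a - m) ^+ 2 <= 2 * K * graph_energy q x.
Proof.
have [m [medr medl]] := weighted_median x a0; exists m.
have sub_sum (A : {set I}) (P : pred I) : (forall a, a \in A -> P a) ->
    \sum_(a in A) mu a <= \sum_(a | P a) mu a.
  move=> AP; rewrite big_mkcond [X in _ <= X]big_mkcond; apply: ler_sum => a _.
  by case: ifP => [/AP -> //|_]; case: ifP.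
have total (A : {set I}) : \sum_a mu a =
    \sum_(a in A) mu a + \sum_(a in ~: A) mu a.
  by rewrite (bigID (mem A)) /=; congr (_ + _); apply: eq_bigl => a; rewrite !inE.
have half (A : {set I}) : \sum_(a in A) mu a <= (\sum_a mu a) / 2 ->
    h * \sum_(a in A) mu a <= graph_energy q (fun a => (a \in A)%:R).
  move=> Ahalf; apply: le_trans (cut_ge A); rewrite ler_pM2l // le_min lexx /=.
  by move: Ahalf; rewrite (total A); lra.
pose f a : R := Num.max (x a - m) 0; pose g a : R := Num.max (m - x a) 0.
have Hf : h ^+ 2 * \sum_a mu a * f a ^+ 2 <= 2 * K * graph_energy q f.
  apply: cheeger_half => [a|A fA]; first by rewrite le_max lexx orbT.
  apply: half; apply: le_trans medr.
  by apply: sub_sum => a /fA; rewrite /f lt_max ltxx orbF subr_gt0.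
have Hg : h ^+ 2 * \sum_a mu a * g a ^+ 2 <= 2 * K * graph_energy q g.
  apply: cheeger_half => [a|A gA]; first by rewrite le_max lexx orbT.
  apply: half; apply: le_trans medl.
  by apply: sub_sum => a /gA; rewrite /g lt_max ltxx orbF subr_gt0.
have -> : \sum_a mu a * (x a - m) ^+ 2 =
    \sum_a mu a * f a ^+ 2 + \sum_a mu a * g a ^+ 2.
  rewrite -big_split; apply: eq_bigr => a _ /=; rewrite -mulrDr; congr (_ * _).
  by rewrite /f /g; case: (leP (x a) m) => xm; case: leP => ?; case: leP => ?; nra.
apply: (@le_trans _ _ (2 * K * (graph_energy q f + graph_energy q g))); first lra.
have K2_ge0 : 0 <= 2 * K by rewrite mulr_ge0 ?ltW.
(* Edge by edge, [(f a - f b)^2 + (g a - g b)^2 <= (x a - x b)^2]: the missing cross term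
   [2 * (f a * g b + f b * g a)] is nonnegative. *)
rewrite ler_wpM2l // /graph_energy -big_split; apply: ler_sum => a _ /=.
rewrite -big_split; apply: ler_sum => b _ /=; rewrite -mulrDr ler_wpM2l //.
rewrite /f /g -(opprB (x a)) -(opprB (x b)).
rewrite (_ : x a - x b = (x a - m) - (x b - m)); last by ring.
move: (x a - m) (x b - m) => u v.
have maxN (w : R) : 0 < w -> Num.max (- w) 0 = 0.
  by move=> w0; apply: max_r; rewrite oppr_le0 ltW.
have maxNl (w : R) : w <= 0 -> Num.max (- w) 0 = - w.
  by move=> w0; apply: max_l; rewrite oppr_ge0.
case: (lerP u 0) => u0; case: (lerP v 0) => v0;
  by rewrite ?(maxN _ u0) ?(maxN _ v0) ?(maxNl _ u0) ?(maxNl _ v0); nra.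
Qed.
End Cheeger.

Local Open Scope classical_set_scope.
Local Open Scope ring_scope.
Local Open Scope complex_scope.
Local Open Scope sesquilinear_scope.

(** * The Hilbert-Schmidt norm *)

Lemma Re_sum (R : realType) (I : Type) (r : seq I) (P : pred I)
    (F : I -> R[i]) :
  complex.Re (\sum_(i <- r | P i) F i) = \sum_(i <- r | P i) complex.Re (F i).
Proof. by apply: (big_morph _ (id1 := 0) (op1 := +%R)) => // -[a b] [c d]. Qed.

Lemma ReM_real (R : realType) (a : R) (z : R[i]) :
  complex.Re (a%:C * z) = a * complex.Re z.
Proof. by case: z => x y /=; rewrite mul0r subr0. Qed.

Lemma cmod_sqr (R : realType) (z : R[i]) : (cmod z ^+ 2)%:C = Num.conj z * z.
Proof.
by rewrite rmorphXn /= /cmod RRe_real ?normr_real // normCK mulrC.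
Qed.

Lemma cmodE (R : realType) (z : R[i]) :
  cmod z ^+ 2 = complex.Re z ^+ 2 + complex.Im z ^+ 2.
Proof. by apply: (@complexI R); rewrite add_Re2_Im2 cmod_sqr normCK mulrC. Qed.

Lemma cmod_ge0 (R : realType) (z : R[i]) : 0 <= cmod z.
Proof. by rewrite /cmod normc_def /= sqrtr_ge0. Qed.

Lemma cmod_real (R : realType) (a : R) : cmod (a%:C) = `|a|.
Proof. by rewrite /cmod normc_def /= expr0n addr0 sqrtr_sqr. Qed.

Lemma cmod_real_sqr (R : realType) (a : R) : cmod (a%:C) ^+ 2 = a ^+ 2.
Proof. by rewrite cmod_real real_normK ?num_real. Qed.

Lemma cmodM (R : realType) (y z : R[i]) : cmod (y * z) = cmod y * cmod z.
Proof.
rewrite /cmod normrM.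
have /complex_realP[a ->] := normr_real y.
have /complex_realP[b ->] := normr_real z.
by rewrite ReM_real.
Qed.

Lemma cmod_conj (R : realType) (z : R[i]) : cmod (Num.conj z) = cmod z.
Proof. by rewrite /cmod norm_conjC. Qed.

Lemma cmod_sum (R : realType) (I : finType) (F : I -> R[i]) :
  cmod (\sum_i F i) <= \sum_i cmod (F i).
Proof.
have /= := @ler_norm_sum _ _ I (index_enum I) F xpredT.
rewrite lecE => /andP[_]; rewrite Re_sum; exact.
Qed.

(** The square of the Hilbert-Schmidt norm; rectangular shapes are allowed so that it covers vectors
    too. *)
Definition hs (R : realType) (m n : nat) (A : 'M[R[i]]_(m, n)) : R :=
  \sum_i \sum_j cmod (A i j) ^+ 2.

Section HilbertSchmidt.
Context (R : realType).
Implicit Types m n p : nat.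

Lemma hs_ge0 m n (A : 'M[R[i]]_(m, n)) : 0 <= hs A.
Proof. by apply: sumr_ge0 => i _; apply: sumr_ge0 => j _; rewrite sqr_ge0. Qed.

Lemma cmod_le_hs m n (A : 'M[R[i]]_(m, n)) i j : cmod (A i j) ^+ 2 <= hs A.
Proof.
rewrite /hs (bigD1 i) //= (bigD1 j) //= -addrA lerDl addr_ge0 //.
  by apply: sumr_ge0 => k _; rewrite sqr_ge0.
by apply: sumr_ge0 => k _; apply: sumr_ge0 => l _; rewrite sqr_ge0.
Qed.

Lemma hs_eq0 m n (A : 'M[R[i]]_(m, n)) : hs A = 0 -> A = 0.
Proof.
move=> A0; apply/matrixP => i j; rewrite mxE.
have cmod0 : cmod (A i j) ^+ 2 = 0.
  by apply/eqP; rewrite eq_le sqr_ge0 -[X in _ <= X]A0 cmod_le_hs.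
apply/eqP; rewrite -normr_eq0 -sqrf_eq0 normCK mulrC -cmod_sqr cmod0.
exact: eqxx.
Qed.

Lemma mxtrace_hs m n (A : 'M[R[i]]_(m, n)) : \tr (A ^t* *m A) = (hs A)%:C.
Proof.
rewrite /mxtrace /hs exchange_big rmorph_sum /=; apply: eq_bigr => j _.
rewrite mxE rmorph_sum; apply: eq_bigr => i _ /=.
by rewrite !mxE cmod_sqr.
Qed.

Lemma trC_mul m n p (A : 'M[R[i]]_(m, n)) (B : 'M[R[i]]_(n, p)) :
  (A *m B) ^t* = B ^t* *m A ^t*.
Proof. by rewrite trmx_mul map_mxM. Qed.

Lemma trC_add m n (A B : 'M[R[i]]_(m, n)) : (A + B) ^t* = A ^t* + B ^t*.
Proof. by apply/matrixP => i j; rewrite !mxE rmorphD. Qed.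

Lemma trC_sub m n (A B : 'M[R[i]]_(m, n)) : (A - B) ^t* = A ^t* - B ^t*.
Proof. by apply/matrixP => i j; rewrite !mxE rmorphB. Qed.

Lemma trC_scale m n (c : R[i]) (A : 'M[R[i]]_(m, n)) :
  (c *: A) ^t* = Num.conj c *: A ^t*.
Proof. by apply/matrixP => i j; rewrite !mxE rmorphM. Qed.

Lemma hs_trC m n (A : 'M[R[i]]_(m, n)) : hs (A ^t*) = hs A.
Proof.
rewrite /hs exchange_big; apply: eq_bigr => i _; apply: eq_bigr => j _.
by rewrite !mxE !cmodE; case: (A i j) => a b /=; rewrite sqrrN.
Qed.

Lemma unitary_trCl n (U : 'M[R[i]]_n) : U \is unitarymx -> U ^t* *m U = 1%:M.
Proof.
move=> Uu; have := Uu; rewrite -trmxC_unitary => /unitarymxP.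
by rewrite trmxCK.
Qed.

Lemma hs_unitaryl m n (U : 'M[R[i]]_m) (A : 'M[R[i]]_(m, n)) :
  U \is unitarymx -> hs (U *m A) = hs A.
Proof.
move=> Uu; apply: (@complexI R).
by rewrite -!mxtrace_hs trC_mul -mulmxA (mulmxA (U ^t*)) unitary_trCl // mul1mx.
Qed.

Lemma hs_unitary n (U A : 'M[R[i]]_n) :
  U \is unitarymx -> hs (U *m A *m U ^t*) = hs A.
Proof.
move=> Uu; rewrite -hs_trC trC_mul trmxCK hs_unitaryl // hs_trC.
by rewrite hs_unitaryl.
Qed.

(** A crude constant suffices: it serves only to show that suprema are finite and that the
    conductance is positive, and does not enter the final estimate. *)
Lemma hs_mulmx_bound m n p (S : 'M[R[i]]_(n, p)) :
  exists2 c : R, 0 <= c & forall v : 'M[R[i]]_(m, n), hs (v *m S) <= c * hs v.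
Proof.
pose c : R := \sum_(i < m) \sum_(j < p) (\sum_(k < n) cmod (S k j)) ^+ 2.
exists c => [|v].
  by apply: sumr_ge0 => i _; apply: sumr_ge0 => j _; rewrite sqr_ge0.
rewrite mulr_suml; apply: ler_sum => i _; rewrite mulr_suml.
apply: ler_sum => j _; rewrite mxE.
have vle k : cmod (v i k) <= Num.sqrt (hs v).
  by rewrite -(ger0_norm (cmod_ge0 _)) -sqrtr_sqr ler_wsqrtr // cmod_le_hs.
rewrite -[X in _ * X](@sqr_sqrtr _ (hs v)) ?hs_ge0 // -exprMn mulr_suml.
rewrite lerXn2r ?nnegrE ?cmod_ge0 //.
  by apply: sumr_ge0 => k _; rewrite mulr_ge0 ?cmod_ge0 ?sqrtr_ge0.
apply: le_trans (cmod_sum _) _; apply: ler_sum => k _.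
by rewrite cmodM mulrC ler_wpM2l ?cmod_ge0.
Qed.

Lemma hs_mxvec m n (A : 'M[R[i]]_(m, n)) : hs (mxvec A) = hs A.
Proof.
rewrite /hs big_ord1 (reindex _ (curry_mxvec_bij _ _)) /= pair_bigA /=.
by apply: eq_bigr => -[i j] _; rewrite mxvecE.
Qed.

Lemma hs_linear_bound m n p k (L : {linear 'M[R[i]]_(m, n) -> 'M[R[i]]_(p, k)}) :
  exists2 c : R, 0 <= c & forall X, hs (L X) <= c * hs X.
Proof.
have [c c0 cP] := hs_mulmx_bound 1 (lin_mx L); exists c => // X.
by rewrite -hs_mxvec -mul_vec_lin -(hs_mxvec X).
Qed.

(* With M the matrix of L acting on row vectors, [M *m pinvmx M *m M = M], so
   [X - pinvmx M (L X)] lies in the kernel of L. *)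
Lemma hs_kernel_bound n (L : {linear 'M[R[i]]_n -> 'M[R[i]]_n}) :
  (forall X, L X = 0 -> exists c : R[i], X = c%:M) ->
  exists2 C : R, 0 <= C &
    forall X, exists c : R[i], hs (X - c%:M) <= C * hs (L X).
Proof.
move=> kerL; have [C C0 CP] := hs_mulmx_bound 1 (pinvmx (lin_mx L)).
exists C => // X.
set v := mxvec (L X) *m pinvmx (lin_mx L).
have [c Xc] : exists c : R[i], X - vec_mx v = c%:M.
  have LXM : (mxvec (L X) <= lin_mx L)%MS by rewrite -mul_vec_lin submxMl.
  apply: kerL; rewrite linearB /= -mx_rV_lin /v mulmxKpV //.
  by rewrite mxvecK subrr.
exists c; rewrite -Xc opprB addrC subrK -hs_mxvec vec_mxK.
by rewrite -(hs_mxvec (L X)) CP.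
Qed.

End HilbertSchmidt.

(** * Functional calculus in an orthonormal basis *)

Lemma conj_mulmx (F : pzSemiRingType) (n : nat) (U V A B : 'M[F]_n) :
  V *m U = 1%:M -> U *m (A *m B) *m V = (U *m A *m V) *m (U *m B *m V).
Proof. by move=> VU; rewrite -!mulmxA (mulmxA V U) VU mul1mx. Qed.

Lemma conj_mulmxK (F : pzSemiRingType) (n : nat) (U V A : 'M[F]_n) :
  V *m U = 1%:M -> V *m (U *m A *m V) *m U = A.
Proof. by move=> VU; rewrite -!mulmxA VU mulmx1 mulmxA VU mul1mx. Qed.

(** The Hermitian matrix with eigenvalue [y a] on the [a]-th column of the adjoint of [U]. For fixed
    [U] this is functional calculus: products are pointwise and indicators give spectral
    projections. *)
Definition udiag (R : realType) (n : nat) (U : 'M[R[i]]_n) (y : 'I_n -> R) :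
    'M[R[i]]_n :=
  U ^t* *m diag_mx (\row_a (y a)%:C) *m U.

Section UnitaryDiagonal.
Context (R : realType) (n : nat) (U : 'M[R[i]]_n).
Implicit Types (y z : 'I_n -> R) (A G W : 'M[R[i]]_n).

Lemma udiag_trC y : (udiag U y) ^t* = udiag U y.
Proof.
rewrite /udiag !trC_mul trmxCK mulmxA tr_diag_mx map_diag_mx.
rewrite (_ : map_mx _ _ = \row_a (y a)%:C) //.
by apply/rowP => a; rewrite !mxE; exact: conjc_real.
Qed.

Lemma mxtrace_udiag G y :
  \tr (G *m udiag U y) = \sum_a (y a)%:C * (U *m G *m U ^t*) a a.
Proof.
rewrite /udiag mulmxA mxtrace_mulC !mulmxA /mxtrace; apply: eq_bigr => a _.
by rewrite mul_mx_diag !mxE mulrC.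
Qed.

Context (U_unitary : U \is unitarymx).

Lemma conj_udiag y : U *m udiag U y *m U ^t* = diag_mx (\row_a (y a)%:C).
Proof.
exact: conj_mulmxK (unitarymxP U_unitary).
Qed.

Lemma udiagM y z : udiag U y *m udiag U z = udiag U (fun a => y a * z a).
Proof.
have E : (\row_a (y a * z a)%:C : 'rV[R[i]]_n) =
    \row_j ((\row_a (y a)%:C) 0 j * (\row_a (z a)%:C) 0 j).
  by apply/rowP => a; rewrite !mxE rmorphM.
by rewrite /udiag E -mulmx_diag (conj_mulmx _ _ (unitarymxP U_unitary)).
Qed.

Lemma udiag_const (c : R) : udiag U (fun=> c) = (c%:C)%:M.
Proof.
rewrite /udiag (_ : \row__ _ = const_mx (c%:C)); last first.
  by apply/rowP => a; rewrite !mxE.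
by rewrite diag_const_mx mul_mx_scalar -scalemxAl unitary_trCl // scalemx1.
Qed.

(** In the eigenbasis the [(a, b)] entry of the commutator is that of [W] times [y b - y a]. This is
    the origin of the weighted graph. *)
Lemma udiag_commutator W y :
  hs (commutator W (udiag U y)) =
  \sum_a \sum_b cmod ((U *m W *m U ^t*) a b) ^+ 2 * (y a - y b) ^+ 2.
Proof.
rewrite -(hs_unitary _ U_unitary) /commutator mulmxBr mulmxBl.
rewrite (conj_mulmx W (udiag U y) (unitary_trCl U_unitary)).
rewrite (conj_mulmx (udiag U y) W (unitary_trCl U_unitary)) conj_udiag.
apply: eq_bigr => a _; apply: eq_bigr => b _.
rewrite mul_mx_diag mul_diag_mx !mxE [X in X - _]mulrC -mulrBl -rmorphB.
rewrite cmodM exprMn cmod_real_sqr; ring.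
Qed.

Lemma hs_udiag_sub y (c : R[i]) :
  hs (udiag U y - c%:M) = \sum_a cmod ((y a)%:C - c) ^+ 2.
Proof.
rewrite -(hs_unitary _ U_unitary) mulmxBr mulmxBl conj_udiag.
rewrite mul_mx_scalar -scalemxAl (unitarymxP U_unitary) scalemx1.
apply: eq_bigr => a _; rewrite (bigD1 a) //= big1 => [|b ba].
  by rewrite !mxE eqxx !mulr1n addr0.
by rewrite !mxE eq_sym (negPf ba) !mulr0n subrr cmod_real normr0 expr0n.
Qed.

Lemma hs_udiag y : hs (udiag U y) = \sum_a y a ^+ 2.
Proof.
have := hs_udiag_sub y 0; rewrite raddf0 subr0 => ->.
by apply: eq_bigr => a _; rewrite subr0 cmod_real_sqr.
Qed.

End UnitaryDiagonal.

Lemma hermitian_udiag (R : realType) (n : nat) (X : 'M[R[i]]_n) :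
  X ^t* = X -> X = udiag (spectralmx X) (fun a => complex.Re (spectral_diag X 0 a)).
Proof.
move=> hX; have herm : X \is hermsymmx.
  by apply/is_hermitianmxP; rewrite expr0 scale1r hX.
have /orthomx_spectralP Xspec := hermitian_normalmx herm.
rewrite (invmx_unitary (spectral_unitarymx X)) in Xspec.
have Xdiag : spectral_diag X =
    \row_a (complex.Re (spectral_diag X 0 a))%:C.
  apply/rowP => a; rewrite mxE.
  have d_real := mxOverP (hermitian_spectral_diag_real herm) 0 a.
  by rewrite (RRe_real d_real).
by rewrite /udiag -Xdiag.
Qed.

Lemma mulmx_delta (F : pzSemiRingType) (n : nat) (M : 'M[F]_n) a b :
  ((delta_mx 0 a : 'rV_n) *m M *m (delta_mx b 0 : 'cV_n)) 0 0 = M a b.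
Proof. by rewrite -rowE -colE !mxE. Qed.

Lemma quadform_diag (R : realType) (n : nat) (U A : 'M[R[i]]_n) a :
  (U *m A *m U ^t*) a a =
  \tr ((U ^t* *m delta_mx a 0 : 'cV_n) ^t* *m A *m (U ^t* *m delta_mx a 0)).
Proof.
rewrite trC_mul trmxCK trmx_delta map_delta_mx /mxtrace big_ord1.
by rewrite -mulmx_delta !mulmxA.
Qed.

Lemma psd_diag (R : realType) (n : nat) (U A : 'M[R[i]]_n) a :
  psdmx A -> 0 <= (U *m A *m U ^t*) a a.
Proof. by move=> A_psd; rewrite quadform_diag; apply: A_psd. Qed.

Lemma posdef_diag (R : realType) (n : nat) (U A : 'M[R[i]]_n) a :
  U \is unitarymx -> posdefmx A -> 0 < (U *m A *m U ^t*) a a.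
Proof.
move=> Uu A_pos; rewrite quadform_diag; apply: A_pos; apply/eqP.
move=> /(congr1 (mulmx U)); rewrite mulmxA (unitarymxP Uu) mul1mx mulmx0.
move=> /matrixP/(_ a 0); rewrite !mxE !eqxx => /eqP; exact/negP/oner_neq0.
Qed.

(* The form of A - A^* vanishes on the diagonal, hence identically by
   polarization. *)
Lemma posdef_hermitian (R : realType) (n : nat) (A : 'M[R[i]]_n) :
  posdefmx A -> A ^t* = A.
Proof.
move=> A_pos; pose B := A - A ^t*.
pose f (u v : 'cV[R[i]]_n) := \tr (u ^t* *m B *m v).
have f0 v : f v v = 0.
  have [->|v0] := eqVneq v 0; first by rewrite /f mulmx0 mxtrace0.
  rewrite /f /B mulmxBr mulmxBl raddfB /=; apply/eqP; rewrite subr_eq0.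
  have -> : v ^t* *m A ^t* *m v = (v ^t* *m A *m v) ^t*.
    by rewrite !trC_mul trmxCK mulmxA.
  have := A_pos v v0; set M := _ *m v => /gtr0_real/CrealP Mr.
  by rewrite -map_trmx mxtrace_tr trace_map_mx /= Mr.
have fDl u u' v : f (u + u') v = f u v + f u' v.
  by rewrite /f trC_add !mulmxDl mxtraceD.
have fDr u v v' : f u (v + v') = f u v + f u v' by rewrite /f mulmxDr mxtraceD.
have fD u v : f u v = - f v u.
  have := f0 (u + v); rewrite fDl !fDr !f0 add0r addr0 => /eqP.
  by rewrite addr_eq0 => /eqP.
have fi u v : f u ('i%C *: v) = 'i%C * f u v.
  by rewrite /f -scalemxAr mxtraceZ.
have fi' u v : f ('i%C *: u) v = - 'i%C * f u v.
  rewrite /f trC_scale -!scalemxAl mxtraceZ; congr (_ * _).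
  by apply/eqP; rewrite eq_complex /= oppr0 !eqxx.
have ff0 u v : f u v = 0.
  (* Antisymmetry at [u] and [i v] reads [i f u v = i f v u], while [f v u = - f u v]; hence
     [2 i f u v = 0]. *)
  have := fD u ('i%C *: v); rewrite fi fi' fD !mulNr opprK mulrN => /eqP.
  rewrite -subr_eq0 -opprD oppr_eq0 -mulr2n mulrn_eq0 /= mulf_eq0.
  case/orP => [|/eqP ->]; last by rewrite oppr0.
  by rewrite eq_complex /= oner_eq0 andbF.
apply/esym/eqP; rewrite -subr_eq0 -/B; apply/eqP/matrixP => i j.
have := ff0 (delta_mx i 0) (delta_mx j 0).
rewrite /f trmx_delta map_delta_mx /mxtrace big_ord1 mulmx_delta => ->.
by rewrite mxE.
Qed.

(** * The KMS inner product *)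

Definition spec_val (R : realType) (n : nat) (D : 'M[R[i]]_n) (a : 'I_n) : R :=
  complex.Re (spectral_diag D 0 a).

Section Kms.
Context (R : realType) (n : nat) (D : 'M[R[i]]_n).
Context (D_posdef : posdefmx D).
Implicit Types X Y A : 'M[R[i]]_n.

Let V := spectralmx D.
Let r := spec_val D.
Let V_unitary : V \is unitarymx. Proof. exact: spectral_unitarymx. Qed.

Lemma posdef_udiag : D = udiag V r.
Proof. exact: hermitian_udiag (posdef_hermitian D_posdef). Qed.

Lemma spec_val_gt0 a : 0 < r a.
Proof.
have := posdef_diag a V_unitary D_posdef.
by rewrite {1}posdef_udiag conj_udiag // !mxE eqxx mulr1n ltcR.
Qed.

Lemma sqrtmx_udiag : sqrtmx D = udiag V (fun a => Num.sqrt (r a)).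
Proof.
rewrite /sqrtmx (invmx_unitary V_unitary) /udiag.
rewrite (_ : map_mx _ _ = \row_a (Num.sqrt (r a))%:C) //.
have D_normal : D \is normalmx.
  by apply/normalmxP; rewrite (posdef_hermitian D_posdef).
apply/rowP => a; rewrite !mxE.
have D_herm : D \is hermsymmx.
  by apply/is_hermitianmxP; rewrite expr0 scale1r (posdef_hermitian D_posdef).
have d_real := mxOverP (hermitian_spectral_diag_real D_herm) 0 a.
rewrite -(RRe_real d_real) -/(spec_val D a) -/r.
rewrite -[X in sqrtC X%:C](sqr_sqrtr (ltW (spec_val_gt0 a))) rmorphXn /=.
by rewrite sqrCK // ler0c sqrtr_ge0.
Qed.

(** In the eigenbasis of [D] the KMS product is an entrywise product with weights
    [sqrt (r a * r b)], so the inequalities below reduce to scalar ones, entry by entry. *)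
Lemma kmsE X Y :
  kms D X Y = \sum_a \sum_b (Num.sqrt (r a) * Num.sqrt (r b))%:C *
    (Num.conj ((V *m X *m V ^t*) a b) * (V *m Y *m V ^t*) a b).
Proof.
rewrite /kms sqrtmx_udiag mxtrace_udiag exchange_big; apply: eq_bigr => b _ /=.
have V1 := unitary_trCl V_unitary.
rewrite (conj_mulmx _ Y V1) (conj_mulmx (X ^t*) _ V1) conj_udiag //.
have -> : V *m X ^t* *m V ^t* = (V *m X *m V ^t*) ^t*.
  by rewrite !trC_mul trmxCK mulmxA.
move: (V *m X *m V ^t*) (V *m Y *m V ^t*) => X' Y'.
rewrite mxE mulr_sumr; apply: eq_bigr => a _.
rewrite mul_mx_diag !mxE rmorphM /=.
move: (Num.conj _) (Y' _ _) (_%:C) (_%:C) => u v s t; ring.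
Qed.

Lemma Re_kms X :
  complex.Re (kms D X X) =
  \sum_a \sum_b Num.sqrt (r a) * Num.sqrt (r b) *
    cmod ((V *m X *m V ^t*) a b) ^+ 2.
Proof.
rewrite kmsE Re_sum; apply: eq_bigr => a _; rewrite Re_sum.
by apply: eq_bigr => b _; rewrite ReM_real -cmod_sqr.
Qed.

Lemma Re_kms_ge0 X : 0 <= complex.Re (kms D X X).
Proof.
rewrite Re_kms; apply: sumr_ge0 => a _; apply: sumr_ge0 => b _.
by rewrite mulr_ge0 ?sqr_ge0 // mulr_ge0 ?sqrtr_ge0.
Qed.

(** Plays the role of the Cauchy-Schwarz inequality; for each entry it amounts to
    [|l x - y|^2 >= 0]. *)
Lemma kms_young X Y (l : R) : 0 < l ->
  2 * complex.Re (kms D X Y) <=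
  l * complex.Re (kms D X X) + l^-1 * complex.Re (kms D Y Y).
Proof.
move=> l0; rewrite kmsE Re_sum.
set S := \sum_i _; rewrite (Re_kms X) (Re_kms Y) /S {S}.
rewrite (mulr_sumr _ _ _ 2) (mulr_sumr _ _ _ l) (mulr_sumr _ _ _ l^-1).
rewrite -big_split.
apply: ler_sum => a _ /=; rewrite Re_sum !mulr_sumr -big_split.
apply: ler_sum => b _ /=; rewrite ReM_real.
set x := (_ *m X *m _) a b; set y := (_ *m Y *m _) a b.
set c := Num.sqrt _ * _; have c0 : 0 <= c by rewrite mulr_ge0 ?sqrtr_ge0.
rewrite mulrCA [l * _]mulrCA [l^-1 * _]mulrCA -mulrDr; apply: ler_wpM2l => //.
rewrite !cmodE; case: x y => [x1 x2] [y1 y2] /=.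
rewrite -(ler_pM2l l0) [X in _ <= X]mulrDr (mulVKf (lt0r_neq0 l0)) -subr_ge0.
set lhs := (X in 0 <= X).
have -> : lhs = (l * x1 - y1) ^+ 2 + (l * x2 - y2) ^+ 2.
  by rewrite /lhs; ring.
by rewrite addr_ge0 ?sqr_ge0.
Qed.

Lemma Re_state_mul_trC X :
  complex.Re (state D (X *m X ^t*)) =
  \sum_a \sum_b r a * cmod ((V *m X *m V ^t*) a b) ^+ 2.
Proof.
rewrite /state mxtrace_mulC {1}posdef_udiag mxtrace_udiag Re_sum.
apply: eq_bigr => a _; rewrite ReM_real.
rewrite (conj_mulmx _ _ (unitary_trCl V_unitary)).
have -> : V *m X ^t* *m V ^t* = (V *m X *m V ^t*) ^t*.
  by rewrite !trC_mul trmxCK mulmxA.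
move: (V *m X *m V ^t*) => X'; rewrite mxE Re_sum mulr_sumr.
by apply: eq_bigr => b _; rewrite !mxE [X in complex.Re X]mulrC -cmod_sqr.
Qed.

Lemma Re_state_trC_mul X :
  complex.Re (state D (X ^t* *m X)) =
  \sum_a \sum_b r b * cmod ((V *m X *m V ^t*) a b) ^+ 2.
Proof.
have := Re_state_mul_trC (X ^t*); rewrite trmxCK => ->.
rewrite [LHS]exchange_big; apply: eq_bigr => a _; apply: eq_bigr => b _.
have -> : V *m X ^t* *m V ^t* = (V *m X *m V ^t*) ^t*.
  by rewrite !trC_mul trmxCK mulmxA.
move: (V *m X *m V ^t*) => X'.
by rewrite !mxE cmod_conj.
Qed.

(** Arithmetic-geometric mean inequality for the weights: [2 sqrt (r a * r b) <= r a + r b]. *)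
Lemma kms_le_state X :
  2 * complex.Re (kms D X X) <=
  complex.Re (state D (X *m X ^t*)) + complex.Re (state D (X ^t* *m X)).
Proof.
rewrite Re_kms (Re_state_mul_trC X) (Re_state_trC_mul X) mulr_sumr -big_split.
apply: ler_sum => a _ /=; rewrite mulr_sumr -big_split.
apply: ler_sum => b _ /=; rewrite mulrA -mulrDl ler_wpM2r ?sqr_ge0 //.
rewrite -[X in _ <= X + _](sqr_sqrtr (ltW (spec_val_gt0 a))).
rewrite -[X in _ <= _ + X](sqr_sqrtr (ltW (spec_val_gt0 b))).
by have := sqr_ge0 (Num.sqrt (r a) - Num.sqrt (r b)); lra.
Qed.

Lemma kms_le_hs X (s : R) : (forall a, r a <= s) ->
  complex.Re (kms D X X) <= s * hs X.
Proof.
move=> rs; rewrite Re_kms -(hs_unitary X V_unitary) mulr_sumr.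
apply: ler_sum => a _; rewrite mulr_sumr; apply: ler_sum => b _.
rewrite ler_wpM2r ?sqr_ge0 // -sqrtrM ?(ltW (spec_val_gt0 _)) //.
have s0 : 0 <= s by apply: le_trans (rs a); rewrite ltW ?spec_val_gt0.
rewrite -[X in _ <= X]ger0_norm // -sqrtr_sqr ler_wsqrtr // expr2.
by rewrite ler_pM // (ltW (spec_val_gt0 _)).
Qed.

Lemma kms_ge_hs X (s : R) : 0 <= s -> (forall a, s <= r a) ->
  s * hs X <= complex.Re (kms D X X).
Proof.
move=> s0 rs; rewrite Re_kms -(hs_unitary X V_unitary) mulr_sumr.
apply: ler_sum => a _; rewrite mulr_sumr; apply: ler_sum => b _.
rewrite ler_wpM2r ?sqr_ge0 // -sqrtrM ?(ltW (spec_val_gt0 _)) //.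
by rewrite -[X in X <= _]ger0_norm // -sqrtr_sqr ler_wsqrtr // expr2 ler_pM.
Qed.

Lemma eigenvalue_spec_val (x : R) : eigenvalue D x%:C <-> exists a, r a = x.
Proof.
have VD : V *m D = diag_mx (\row_a (r a)%:C) *m V.
  rewrite -(conj_udiag V_unitary) -posdef_udiag -mulmxA unitary_trCl //.
  by rewrite mulmx1.
split=> [/eigenvalueP[v vD v0]|[a <-]]; last first.
  (* [eigenvalue] refers to row vectors, and by [VD] each row of [V] is a left eigenvector of
     [D]. *)
  apply/eigenvalueP; exists (row a V).
    by rewrite -row_mul VD; apply/rowP => b; rewrite mul_diag_mx !mxE.
  apply/eqP => /(congr1 (mulmx^~ (V ^t*))); rewrite -row_mul mul0mx.
  rewrite (unitarymxP V_unitary) => /rowP/(_ a); rewrite !mxE eqxx => /eqP.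
  exact/negP/oner_neq0.
pose w := v *m V ^t*.
have wE : w *m diag_mx (\row_a (r a)%:C) = x%:C *: w.
  rewrite -(conj_udiag V_unitary) -posdef_udiag /w !mulmxA.
  by rewrite -(mulmxA v) unitary_trCl // mulmx1 vD scalemxAl.
have /rV0Pn[a wa] : w != 0.
  apply/eqP => /(congr1 (mulmx^~ V)); rewrite /w -mulmxA unitary_trCl //.
  by rewrite mulmx1 mul0mx; apply/eqP.
exists a; apply: (@complexI R); apply: (mulfI wa).
by have /rowP/(_ a) := wE; rewrite mul_mx_diag !mxE => ->; rewrite mulrC.
Qed.

Lemma smallest_eigenvalue_le a : smallest_eigenvalue D <= r a.
Proof.
apply: ge_inf; last by rewrite /= eigenvalue_spec_val; exists a.
exists 0 => x /=; rewrite eigenvalue_spec_val => -[b <-].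
by rewrite ltW ?spec_val_gt0.
Qed.

Lemma largest_eigenvalue_ge a : r a <= largest_eigenvalue D.
Proof.
apply: ub_le_sup; last by rewrite /= eigenvalue_spec_val; exists a.
exists (\sum_b r b) => x /=; rewrite eigenvalue_spec_val => -[b <-].
rewrite (bigD1 b) //= lerDl; apply: sumr_ge0 => c _.
by rewrite ltW ?spec_val_gt0.
Qed.

(** The infimum is bounded below by the least of finitely many positive numbers. The index [a0]
    makes the spectrum nonempty; the infimum of the empty set is 0 by convention. *)
Lemma smallest_eigenvalue_gt0 (a0 : 'I_n) : 0 < smallest_eigenvalue D.
Proof.
case: (@arg_minP _ _ _ a0 xpredT r isT) => a _ min_a.
apply: lt_le_trans (spec_val_gt0 a) _; apply: lb_le_inf.
  by exists (r a) => /=; rewrite eigenvalue_spec_val; exists a.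
by move=> x /=; rewrite eigenvalue_spec_val => -[b <-]; apply: min_a.
Qed.

End Kms.

(** * Operator norms and the Dirichlet form *)

(** Recovers a Cauchy-Schwarz bound from Young's inequality: the weight [l] balances the two terms
    when [c = l^2 * b]. *)
Lemma young_balance (R : realFieldType) (a b c l : R) :
  0 < l -> 2 * a <= l * b + l^-1 * c -> c <= l ^+ 2 * b -> a <= l * b.
Proof.
move=> l0 young c_le; have : l^-1 * c <= l * b.
  by rewrite ler_pdivrMl // mulrA.
by lra.
Qed.

(** The term [k^-1 * b] is at most [a] and is absorbed on the left. It will be used with
    [a = |L X|^2], [b = <L X, L (L X)>] and [c = <X, L X>]. *)
Lemma young_absorb (R : realFieldType) (a b c e k : R) :
  0 < k -> 2 * a <= k^-1 * b + k * c -> b <= e -> e <= k * a -> a <= k * c.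
Proof.
move=> k0 young be ea; have : k^-1 * b <= a.
  by rewrite ler_pdivrMl //; apply: le_trans be ea.
by lra.
Qed.

Lemma young_sum (R : numDomainType) (I : finType) (a b c k l : R) (f g h : I -> R) :
  a = \sum_i f i -> b = \sum_i g i -> c = \sum_i h i ->
  (forall i, 2 * f i <= k * g i + l * h i) -> 2 * a <= k * b + l * c.
Proof.
move=> -> -> -> young; rewrite !mulr_sumr -big_split.
exact: ler_sum.
Qed.

(** If [e_a] denotes the [a]-th column of the adjoint of [U], this is the sum over [j] of
    [|<e_a, W_j e_b>|^2]. *)
Definition edge_weight (R : realType) (n m : nat) (W : 'I_m -> 'M[R[i]]_n)
    (U : 'M[R[i]]_n) (a b : 'I_n) : R :=
  \sum_j cmod ((U *m W j *m U ^t*) a b) ^+ 2.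

Lemma vnormE (R : realType) (n : nat) (v : 'cV[R[i]]_n) :
  vnorm v = Num.sqrt (hs v).
Proof. by congr Num.sqrt; apply: eq_bigr => i _; rewrite big_ord1. Qed.

Lemma quadform_le_opnorm (R : realType) (n : nat) (A : 'M[R[i]]_n)
    (v : 'cV[R[i]]_n) :
  opnorm A <= 1 -> hs v <= 1 -> complex.Re (\tr (v ^t* *m A *m v)) <= 1.
Proof.
move=> A1 v1.
have sqrt1 (x : R) : (Num.sqrt x <= 1) = (x <= 1).
  by rewrite -[in LHS]sqrtr1 ler_sqrt.
have Av1 : hs (A *m v) <= 1.
  rewrite -sqrt1 -vnormE.
  apply: le_trans A1; apply: ub_le_sup; last first.
    by exists v => //=; rewrite vnormE sqrt1.
  (* The set defining [opnorm] must be bounded for [sup] to be an upper bound. The adjoint appears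
     because [hs_mulmx_bound] concerns multiplication on the right. *)
  have [c c0 cP] := hs_mulmx_bound 1 (A ^t*).
  exists (Num.sqrt c) => _ [w /= w1 <-]; rewrite vnormE ler_wsqrtr //.
  rewrite -hs_trC trC_mul; apply: le_trans (cP _) _; rewrite hs_trC.
  rewrite -[X in _ <= X]mulr1 ler_wpM2l //.
  by move: w1; rewrite vnormE sqrt1.
rewrite -mulmxA; move: (A *m v) Av1 => w w1.
suff : 2 * complex.Re (\tr (v ^t* *m w)) <= hs v + hs w by lra.
rewrite /mxtrace big_ord1 mxE Re_sum mulr_sumr -big_split.
apply: ler_sum => i _; rewrite !big_ord1 !mxE !cmodE.
case: (v i 0) (w i 0) => [a b] [c d] /=.
by have := sqr_ge0 (a - c); have := sqr_ge0 (b - d); lra.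
Qed.

Section Dirichlet.
Context (R : realType) (n : nat) (D : 'M[R[i]]_n).
Context (L : {linear 'M[R[i]]_n -> 'M[R[i]]_n}).
Context (D_posdef : posdefmx D).
Implicit Types X Y P : 'M[R[i]]_n.

Let s := smallest_eigenvalue D.
Let t := largest_eigenvalue D.

Section NonemptyIndex.
Context (a0 : 'I_n).

Let s_gt0 : 0 < s. Proof. exact: smallest_eigenvalue_gt0 a0. Qed.

Lemma kms_ge_smallest X : s * hs X <= complex.Re (kms D X X).
Proof.
apply: kms_ge_hs => //; first exact: ltW.
exact: smallest_eigenvalue_le.
Qed.

Lemma kms_le_largest X : complex.Re (kms D X X) <= t * hs X.
Proof. by apply: kms_le_hs => //; exact: largest_eigenvalue_ge. Qed.

Lemma largest_eigenvalue_gt0 : 0 < t.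
Proof.
exact: lt_le_trans (spec_val_gt0 D_posdef a0) (largest_eigenvalue_ge _ _).
Qed.

Lemma kms_norm_gt0 X : X != 0 -> 0 < kms_norm D X.
Proof.
move=> X0; rewrite /kms_norm sqrtr_gt0; apply: lt_le_trans (kms_ge_smallest X).
rewrite mulr_gt0 // lt_def hs_ge0 andbT.
by apply: contra X0 => /eqP/hs_eq0 ->.
Qed.

Let ratios : set R :=
  [set kms_norm D (L X) / kms_norm D X | X in [set X | X != 0]].

(** Boundedness is what makes the supremum [kms_mapnorm D L] an upper bound of the ratios. It
    follows by passing to the Hilbert-Schmidt norm and back, at the cost of [t] and [s]. *)
Lemma kms_ratio_bounded : has_ubound ratios.
Proof.
have [c c0 cP] := hs_linear_bound L.
exists (Num.sqrt (t * c / s)) => _ [X /= X0 <-].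
rewrite ler_pdivrMr ?kms_norm_gt0 // /kms_norm -sqrtrM; last first.
  by rewrite divr_ge0 ?mulr_ge0 // ltW // largest_eigenvalue_gt0.
apply: ler_wsqrtr; apply: le_trans (kms_le_largest _) _.
rewrite -!mulrA ler_pM2l ?largest_eigenvalue_gt0 //.
apply: le_trans (cP X) _; apply: ler_wpM2l => //.
by rewrite ler_pdivlMl // kms_ge_smallest.
Qed.

Lemma kms_mapnorm_ge0 : 0 <= kms_mapnorm D L.
Proof.
have n0 : (1%:M : 'M[R[i]]_n) != 0.
  apply/eqP => /matrixP/(_ a0 a0); rewrite !mxE eqxx => /eqP.
  exact/negP/oner_neq0.
apply: (@le_trans _ _ (kms_norm D (L 1%:M) / kms_norm D 1%:M)).
  by rewrite divr_ge0 // sqrtr_ge0.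
by apply: ub_le_sup; [exact: kms_ratio_bounded|exists 1%:M].
Qed.

Lemma kms_mapnorm_le X :
  complex.Re (kms D (L X) (L X)) <=
  kms_mapnorm D L ^+ 2 * complex.Re (kms D X X).
Proof.
have [->|X0] := eqVneq X 0.
  rewrite linear0 /kms mulmx0 mul0mx mxtrace0 /= mulr0; exact: lexx.
have ratio : kms_norm D (L X) / kms_norm D X <= kms_mapnorm D L.
  by apply: ub_le_sup; [exact: kms_ratio_bounded|exists X].
move: ratio; rewrite ler_pdivrMr ?kms_norm_gt0 // => ratio.
have kms_sqr Z : complex.Re (kms D Z Z) = kms_norm D Z ^+ 2.
  by rewrite sqr_sqrtr // Re_kms_ge0.
rewrite (kms_sqr (L X)) (kms_sqr X) -exprMn lerXn2r // nnegrE ?sqrtr_ge0 //.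
by rewrite mulr_ge0 ?sqrtr_ge0 ?kms_mapnorm_ge0.
Qed.

Lemma kms_form_le X :
  complex.Re (kms D X (L X)) <= kms_mapnorm D L * complex.Re (kms D X X).
Proof.
have := kms_mapnorm_le X; have := kms_mapnorm_ge0; set l := kms_mapnorm D L.
(* Young's inequality with weight [l] requires [l > 0]; when [l = 0], [L X] vanishes and so does the
   form. *)
rewrite le_eqVlt => /orP[/eqP <-|l0] LX.
  have LX0 : L X = 0.
    apply: hs_eq0; apply/eqP; rewrite eq_le hs_ge0 andbT.
    rewrite -(ler_pM2l s_gt0) mulr0; apply: le_trans (kms_ge_smallest _) _.
    by move: LX; rewrite expr0n mul0r.
  rewrite LX0 mul0r /kms mulmx0 mul0mx mxtrace0; exact: lexx.
exact: young_balance l0 (kms_young D_posdef X (L X) l0) LX.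
Qed.

Context (m : nat) (W : 'I_m -> 'M[R[i]]_n).
Context (L_dirichlet : forall X Y,
  kms D X (L Y) = \sum_(j < m) kms D (commutator (W j) X) (commutator (W j) Y)).

Lemma Re_dirichlet X Y : complex.Re (kms D X (L Y)) =
  \sum_j complex.Re (kms D (commutator (W j) X) (commutator (W j) Y)).
Proof. by rewrite L_dirichlet Re_sum. Qed.

Lemma Re_dirichlet_ge0 X : 0 <= complex.Re (kms D X (L X)).
Proof. by rewrite Re_dirichlet; apply: sumr_ge0 => j _; apply: Re_kms_ge0. Qed.

Lemma sum_hs_commutator U y : U \is unitarymx ->
  \sum_j hs (commutator (W j) (udiag U y)) = graph_energy (edge_weight W U) y.
Proof.
move=> U_unitary.
under eq_bigr => j _ do rewrite udiag_commutator //.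
rewrite exchange_big; apply: eq_bigr => a _.
rewrite exchange_big; apply: eq_bigr => b _.
by rewrite mulr_suml.
Qed.

Lemma dirichlet_ge_energy U y : U \is unitarymx ->
  s * graph_energy (edge_weight W U) y <= complex.Re (kms D (udiag U y) (L (udiag U y))).
Proof.
move=> U_unitary; rewrite -sum_hs_commutator // Re_dirichlet mulr_sumr.
by apply: ler_sum => j _; apply: kms_ge_smallest.
Qed.

Lemma dirichlet_le_energy U y : U \is unitarymx ->
  complex.Re (kms D (udiag U y) (L (udiag U y))) <= t * graph_energy (edge_weight W U) y.
Proof.
move=> U_unitary; rewrite -sum_hs_commutator // Re_dirichlet mulr_sumr.
by apply: ler_sum => j _; apply: kms_le_largest.
Qed.

(* Young's inequality for the semi-inner product [<X, L Y>], with weight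
   [l = 1 / (|L| + 1)] so that [l |L| <= 1]. *)
Lemma kms_image_le X : complex.Re (kms D (L X) (L X)) <=
  (kms_mapnorm D L + 1) * complex.Re (kms D X (L X)).
Proof.
set k := kms_mapnorm D L + 1.
have k_gt0 : 0 < k by rewrite ltr_wpDl // kms_mapnorm_ge0.
have ki_gt0 : 0 < k^-1 by rewrite invr_gt0.
have le_young : 2 * complex.Re (kms D (L X) (L X)) <=
    k^-1 * complex.Re (kms D (L X) (L (L X)))
    + k * complex.Re (kms D X (L X)).
  apply: (young_sum (Re_dirichlet (L X) X) (Re_dirichlet (L X) (L X))
    (Re_dirichlet X X)) => j.
  have := kms_young D_posdef (commutator (W j) (L X)) (commutator (W j) X) ki_gt0.
  by rewrite invrK.
apply: (young_absorb k_gt0 le_young (kms_form_le _)).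
by rewrite ler_wpM2r ?Re_kms_ge0 // lerDl.
Qed.

Context (L_kernel : forall X, L X = 0 -> exists c : R[i], X = c%:M).

(** A spectral gap, with [c] depending on [X]: [|X - c|_HS^2 <= C0 |L X|_HS^2 <= (C0 / s) |L
    X|_KMS^2 <= (C0 k / s) <X, L X>]. *)
Lemma dirichlet_coercive : exists2 C : R, 0 < C &
  forall X, exists c : R[i], hs (X - c%:M) <= C * complex.Re (kms D X (L X)).
Proof.
have [C0 C0_ge0 hsL] := hs_kernel_bound L_kernel.
pose k := kms_mapnorm D L + 1.
have k_gt0 : 0 < k by rewrite ltr_wpDl // kms_mapnorm_ge0.
(* [C0] may be 0; adding 1 keeps the constant strictly positive. *)
exists ((C0 + 1) * (s^-1 * k)) => [|X].
  by rewrite mulr_gt0 ?ltr_wpDl // mulr_gt0 ?invr_gt0.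
have [c Xc] := hsL X; exists c; apply: le_trans Xc _; rewrite -mulrA.
apply: ler_pM; rewrite ?hs_ge0 ?lerDl // -mulrA ler_pdivlMl //.
exact: le_trans (kms_ge_smallest _) (kms_image_le _).
Qed.

End NonemptyIndex.
End Dirichlet.

(** * Conductance *)

Lemma udiag_inj (R : realType) (n : nat) (U : 'M[R[i]]_n) (y z : 'I_n -> R) :
  U \is unitarymx -> udiag U y = udiag U z -> y =1 z.
Proof.
move=> U_unitary yz a; apply: (@complexI R).
have := conj_udiag U_unitary y; rewrite yz (conj_udiag U_unitary) => /matrixP/(_ a a).
by rewrite !mxE eqxx !mulr1n.
Qed.

Lemma projection_compl (R : realType) (n : nat) (P : 'M[R[i]]_n) :
  projection P -> projection (1%:M - P).
Proof.
move=> [Pt PP]; split.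
  apply/matrixP => i j; rewrite !mxE rmorphB; congr (_ - _).
    by rewrite eq_sym; case: (i == j); [exact: rmorph1|exact: rmorph0].
  by have /matrixP/(_ i j) := Pt; rewrite !mxE.
by rewrite mulmxBr mulmx1 mulmxBl mul1mx PP subrr subr0.
Qed.

Lemma projection_udiag_set (R : realType) (n : nat) (U : 'M[R[i]]_n)
    (A : {set 'I_n}) :
  U \is unitarymx -> projection (udiag U (fun a => (a \in A)%:R)).
Proof.
move=> U_unitary; split; first exact: udiag_trC.
rewrite (udiagM U_unitary); congr (udiag U _); apply/funext => a.
by case: (a \in A); rewrite ?mulr1 ?mulr0.
Qed.

Lemma udiag0 (R : realType) (n : nat) (U : 'M[R[i]]_n) :
  udiag U (fun=> 0) = 0.
Proof.
rewrite /udiag (_ : diag_mx _ = 0) ?mulmx0 ?mul0mx //.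
by apply/matrixP => a b; rewrite !mxE mul0rn.
Qed.

Lemma udiag1 (R : realType) (n : nat) (U : 'M[R[i]]_n) :
  U \is unitarymx -> udiag U (fun=> 1) = 1%:M.
Proof. by move=> U_unitary; rewrite udiag_const. Qed.

Lemma udiag_set_neq0 (R : realType) (n : nat) (U : 'M[R[i]]_n)
    (A : {set 'I_n}) a :
  U \is unitarymx -> a \in A -> udiag U (fun a => (a \in A)%:R) != 0.
Proof.
move=> U_unitary aA; apply/eqP; rewrite -(udiag0 U).
by move=> /(udiag_inj U_unitary)/(_ a)/eqP; rewrite aA oner_eq0.
Qed.

Lemma udiag_set_neq1 (R : realType) (n : nat) (U : 'M[R[i]]_n)
    (A : {set 'I_n}) b :
  U \is unitarymx -> b \notin A -> udiag U (fun a => (a \in A)%:R) != 1%:M.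
Proof.
move=> U_unitary bA; apply/eqP; rewrite -(udiag1 U_unitary).
move=> /(udiag_inj U_unitary)/(_ b)/eqP.
by rewrite (negPf bA) eq_sym oner_eq0.
Qed.

(** Such a projection has both eigenvalues 1 and 0, and [|1 - c|^2 + |c|^2 >= 1/2] for every complex
    [c]. *)
Lemma projection_scalar_dist (R : realType) (n : nat) (P : 'M[R[i]]_n)
    (c : R[i]) :
  projection P -> P != 0 -> P != 1%:M -> 1 <= 2 * hs (P - c%:M).
Proof.
move=> [Pt PP] P0 P1.
have Pdiag := hermitian_udiag Pt.
have Uu := spectral_unitarymx P.
move: (spectralmx P) (fun a => _) Pdiag Uu => U y Pdiag Uu.
have yy a : y a * y a = y a.
  have := PP; rewrite Pdiag (udiagM Uu) => /(udiag_inj Uu); exact.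
have [a ya] : exists a, y a = 1.
  have [a ya0] : exists a, y a != 0.
    apply/existsP; apply: contraR P0 => /existsPn y0; rewrite Pdiag.
    have -> : y = fun=> 0.
      by apply/funext => a; have := y0 a; rewrite negbK => /eqP.
    by rewrite udiag0.
  by exists a; apply: (mulfI ya0); rewrite yy mulr1.
have [b yb] : exists b, y b = 0.
  have [b yb1] : exists b, y b != 1.
    apply/existsP; apply: contraR P1 => /existsPn y1; rewrite Pdiag.
    have -> : y = fun=> 1.
      by apply/funext => b; have := y1 b; rewrite negbK => /eqP.
    by rewrite udiag1.
  exists b; apply/eqP; move/eqP: (yy b).
  rewrite -subr_eq0 -{3}(mulr1 (y b)) -mulrBr mulf_eq0 subr_eq0.
  by rewrite (negPf yb1) orbF.
have ab : b != a.
  by apply/eqP => ba; move: yb; rewrite ba ya => /eqP; rewrite oner_eq0.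
rewrite Pdiag hs_udiag_sub // (bigD1 a) //= (bigD1 b) //= ya yb.
have rest : 0 <= \sum_(i | (i != a) && (i != b)) cmod ((y i)%:C - c) ^+ 2.
  by apply: sumr_ge0 => k _; rewrite sqr_ge0.
move: rest; set S := \sum_(i | _) _; move: S => S S0.
rewrite !cmodE; case: c => c d /=.
by have := sqr_ge0 (2 * c - 1); have := sqr_ge0 d; lra.
Qed.

Lemma exists_nontrivial_projection (R : realType) (n : nat) (a b : 'I_n) :
  b != a -> exists P : 'M[R[i]]_n, projection P /\ P != 0 /\ P != 1%:M.
Proof.
(* The zero matrix only serves to supply some unitary matrix. *)
move=> ba; have := spectral_unitarymx (0 : 'M[R[i]]_n).
move: (spectralmx _) => U U_unitary.
exists (udiag U (fun k => (k \in [set a]%SET)%:R)).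
split; first by apply: projection_udiag_set.
split; first by apply: (udiag_set_neq0 (a := a) U_unitary); rewrite inE.
by apply: (udiag_set_neq1 (b := b) U_unitary); rewrite inE.
Qed.

Section Conductance.
Context (R : realType) (n : nat) (D : 'M[R[i]]_n).
Context (L : {linear 'M[R[i]]_n -> 'M[R[i]]_n}).
Context (m : nat) (W : 'I_m -> 'M[R[i]]_n) (a0 : 'I_n).
Context (D_posdef : posdefmx D).
Context (D_tr1 : \tr D = 1).
Context (L_dirichlet : forall X Y,
  kms D X (L Y) = \sum_(j < m) kms D (commutator (W j) X) (commutator (W j) Y)).
Implicit Types X Y P : 'M[R[i]]_n.

Let s := smallest_eigenvalue D.
Let t := largest_eigenvalue D.
Let h := conductance D L.
Let l := kms_mapnorm D L.
Let s_gt0 : 0 < s. Proof. exact: smallest_eigenvalue_gt0 a0. Qed.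
Let t_gt0 : 0 < t. Proof. exact: largest_eigenvalue_gt0 a0. Qed.

(** Both products in [kms_le_state] reduce to [P] itself. *)
Lemma kms_projection_le P : projection P ->
  complex.Re (kms D P P) <= complex.Re (state D P).
Proof.
move=> [Pt PP]; have := kms_le_state D_posdef P.
by rewrite Pt PP -mulr2n -[X in _ <= X]mulr_natl ler_pM2l.
Qed.

Lemma state_projection_ge P : projection P ->
  s * hs P <= complex.Re (state D P).
Proof.
move=> Pp; apply: le_trans (kms_projection_le Pp).
exact: kms_ge_smallest D_posdef a0 P.
Qed.

Lemma Re_state_compl P :
  complex.Re (state D (1%:M - P)) = 1 - complex.Re (state D P).
Proof.
rewrite /state mulmxBr mulmx1 raddfB /= D_tr1.
by case: (\tr (D *m P)).
Qed.

Lemma state_projection_gt0 P : projection P -> P != 0 ->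
  0 < complex.Re (state D P).
Proof.
move=> Pp P0; apply: lt_le_trans (state_projection_ge Pp).
rewrite mulr_gt0 // lt_def hs_ge0 andbT.
by apply: contra P0 => /eqP/hs_eq0 ->.
Qed.

Lemma min_state_gt0 P : projection P -> P != 0 -> P != 1%:M ->
  0 < Num.min (complex.Re (state D P)) (1 - complex.Re (state D P)).
Proof.
move=> Pp P0 P1; rewrite lt_min state_projection_gt0 //= -Re_state_compl.
apply: state_projection_gt0; first exact: projection_compl.
by rewrite subr_eq0 eq_sym.
Qed.

(** The quotients are nonnegative, so their infimum is indeed a lower bound. *)
Lemma conductance_le P : projection P -> P != 0 -> P != 1%:M ->
  h * Num.min (complex.Re (state D P)) (1 - complex.Re (state D P)) <=
  complex.Re (kms D P (L P)).
Proof.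
move=> Pp P0 P1; rewrite -ler_pdivlMr ?min_state_gt0 //.
apply: ge_inf; last by exists P.
exists 0 => _ [Q /= [Qp [Q0 Q1]] <-].
by rewrite divr_ge0 ?(Re_dirichlet_ge0 D_posdef L_dirichlet) // ltW // min_state_gt0.
Qed.

Context (L_kernel : forall X, L X = 0 -> exists c : R[i], X = c%:M).

Lemma conductance_gt0 (a1 : 'I_n) : a1 != a0 -> 0 < h.
Proof.
move=> a10.
have [C C_gt0 CP] := dirichlet_coercive D_posdef a0 L_dirichlet L_kernel.
have C2_gt0 : 0 < 2 * C by rewrite mulr_gt0.
(* This is a lower bound for every quotient: the denominator is at most 1, and
   [1 <= 2 |P - c|_HS^2 <= 2 C <P, L P>]. The two distinct indices ensure that the infimum is over a
   nonempty set. *)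
apply: (@lt_le_trans _ _ (2 * C)^-1); first by rewrite invr_gt0.
apply: lb_le_inf.
  have [P Pproj] := exists_nontrivial_projection R a10.
  by eexists; exact: (ex_intro2 _ _ P Pproj (erefl _)).
move=> _ [P /= [Pp [P0 P1]] <-].
have [c Pc] := CP P.
have min_gt0 := min_state_gt0 Pp P0 P1.
rewrite ler_pdivlMr // ler_pdivrMl //.
apply: (@le_trans _ _ 1).
  have st0 := state_projection_gt0 Pp P0.
  rewrite ge_min; apply/orP; right.
  by rewrite lerBlDr lerDl ltW.
rewrite -mulrA; apply: le_trans (projection_scalar_dist c Pp P0 P1) _.
by rewrite ler_pM2l.
Qed.

End Conductance.

(** * Oscillation bound *)

(** Here [d] is a difference of eigenvalues, [S] the variance around the median and [e] the graph
    energy. Chaining the hypotheses gives [d^2 <= 4 (t / h)^2 (l / s) / s^2]. *)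
Lemma oscillation_arith (R : rcfType) (s t h l d S e : R) :
  0 < s -> 0 < t -> 0 < h -> 0 < l ->
  s * d ^+ 2 <= 2 * S -> (h / t) ^+ 2 * S <= 2 * (l / s) * e -> s * e <= 1 ->
  `|d| <= 2 * t / (s * h) * Num.sqrt (l / s).
Proof.
move=> s0 t0 h0 l0 dS Se e1.
have ls0 : 0 <= l / s by rewrite divr_ge0 ?ltW.
have c0 : 0 <= 2 * t / (s * h) by rewrite divr_ge0 ?mulr_ge0 ?ltW.
have rhs0 := mulr_ge0 c0 (sqrtr_ge0 (l / s)).
rewrite -(ler_pXn2r (ltn0Sn 1)) ?nnegrE //.
rewrite exprMn sqr_sqrtr // real_normK ?num_real //.
have hts0 : 0 < (h / t) ^+ 2 * s by rewrite !mulr_gt0 ?invr_gt0.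
rewrite -(ler_pM2l hts0).
apply: (@le_trans _ _ (2 * (2 * (l / s) * e))).
  apply: (@le_trans _ _ (2 * ((h / t) ^+ 2 * S))); last by rewrite ler_pM2l.
  by rewrite -mulrA [X in _ <= X]mulrCA ler_pM2l // exprn_gt0 // divr_gt0.
have -> : (h / t) ^+ 2 * s * ((2 * t / (s * h)) ^+ 2 * (l / s)) =
    2 * (2 * (l / s) * s^-1).
  by field; rewrite !gt_eqF.
have ls2 : 0 < 2 * (l / s) by rewrite mulr_gt0 // divr_gt0.
rewrite (ler_pM2l (ltr0Sn R 1)) (ler_pM2l ls2).
by rewrite -[X in _ <= X]mulr1 ler_pdivlMl.
Qed.

Lemma edge_weight_ge0 (R : realType) (n m : nat) (W : 'I_m -> 'M[R[i]]_n)
    (U : 'M[R[i]]_n) a b : 0 <= edge_weight W U a b.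
Proof. by apply: sumr_ge0 => j _; rewrite sqr_ge0. Qed.

Section Oscillation.
Context (R : realType) (n : nat) (D : 'M[R[i]]_n).
Context (L : {linear 'M[R[i]]_n -> 'M[R[i]]_n}).
Context (m : nat) (W : 'I_m -> 'M[R[i]]_n) (a0 a1 : 'I_n).
Context (a10 : a1 != a0).
Context (D_posdef : posdefmx D).
Context (D_tr1 : \tr D = 1).
Context (L_dirichlet : forall X Y,
  kms D X (L Y) = \sum_(j < m) kms D (commutator (W j) X) (commutator (W j) Y)).
Context (L_kernel : forall X, L X = 0 -> exists c : R[i], X = c%:M).

Let s := smallest_eigenvalue D.
Let t := largest_eigenvalue D.
Let h := conductance D L.
Let l := kms_mapnorm D L.
Let s_gt0 : 0 < s. Proof. exact: smallest_eigenvalue_gt0 a0. Qed.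
Let t_gt0 : 0 < t. Proof. exact: largest_eigenvalue_gt0 a0. Qed.
Let h_gt0 : 0 < h.
Proof. exact: (conductance_gt0 D_posdef D_tr1 L_dirichlet L_kernel a10). Qed.

(** A nontrivial projection has positive Dirichlet form since [h > 0], which [l = 0] would
    contradict. This makes the degree constant [l / s] positive, as Cheeger's inequality asks. *)
Lemma kms_mapnorm_gt0 : 0 < l.
Proof.
have [P [Pp [P0 P1]]] := exists_nontrivial_projection R a10.
have cond := conductance_le a0 D_posdef D_tr1 L_dirichlet Pp P0 P1.
have min_gt0 := min_state_gt0 a0 D_posdef D_tr1 Pp P0 P1.
have l0 : 0 <= l by exact: kms_mapnorm_ge0 a0.
rewrite lt_def l0 andbT; apply/eqP => l_eq0.
have := lt_le_trans (mulr_gt0 h_gt0 min_gt0) cond.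
have form := kms_form_le L D_posdef a0 P.
move=> /lt_le_trans/(_ form); rewrite -/l l_eq0 mul0r.
by rewrite ltxx.
Qed.

Section Eigenbasis.
Context (U : 'M[R[i]]_n).
Context (U_unitary : U \is unitarymx).

Let mu a : R := complex.Re ((U *m D *m U ^t*) a a).
Let energy := graph_energy (edge_weight W U).

Lemma Re_state_udiag y :
  complex.Re (state D (udiag U y)) = \sum_a y a * mu a.
Proof.
rewrite /state mxtrace_udiag Re_sum; apply: eq_bigr => a _.
exact: ReM_real.
Qed.

Lemma Re_state_udiag_set (A : {set 'I_n}) :
  complex.Re (state D (udiag U (fun a => (a \in A)%:R))) = \sum_(a in A) mu a.
Proof.
rewrite Re_state_udiag [RHS]big_mkcond; apply: eq_bigr => a _.
by case: ifP => _; rewrite ?mul1r ?mul0r.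
Qed.

Lemma mu_sum : \sum_a mu a = 1.
Proof.
have := Re_state_udiag (fun=> 1); rewrite udiag1 // /state mulmx1 D_tr1.
by move=> /= ->; apply: eq_bigr => a _; rewrite mul1r.
Qed.

Lemma mu_ge a : s <= mu a.
Proof.
have Pp := projection_udiag_set [set a]%SET U_unitary.
have := state_projection_ge a0 D_posdef Pp.
rewrite Re_state_udiag_set big_set1 hs_udiag // => /(le_trans _); apply.
rewrite -[X in X <= _]mulr1 ler_pM2l // (bigD1 a) //= inE eqxx expr1n lerDl.
by apply: sumr_ge0 => b _; rewrite sqr_ge0.
Qed.

(** For the spectral projection [P] of [a]: [s * energy <= <P, L P> <= l |P|_KMS^2 <= l rho(P)], and
    [rho(P) = mu a]. *)
Lemma energy_set1_le a :
  energy (fun b => (b \in [set a]%SET)%:R) <= l / s * mu a.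
Proof.
have Pp := projection_udiag_set [set a]%SET U_unitary.
have lower := dirichlet_ge_energy D_posdef a0 L_dirichlet
  (fun b => (b \in [set a]%SET)%:R) U_unitary.
rewrite mulrAC ler_pdivlMr // mulrC; apply: le_trans lower _.
apply: le_trans (kms_form_le L D_posdef a0 _) _.
rewrite ler_pM2l ?kms_mapnorm_gt0 //.
apply: le_trans (kms_projection_le D_posdef Pp) _.
by rewrite Re_state_udiag_set big_set1.
Qed.

Lemma conductance_le_energy (A : {set 'I_n}) :
  h / t * Num.min (\sum_(a in A) mu a) (\sum_(a in ~: A) mu a) <=
  energy (fun a => (a \in A)%:R).
Proof.
have energy_ge0 : 0 <= energy (fun a => (a \in A)%:R).
  apply: sumr_ge0 => a _; apply: sumr_ge0 => b _.
  by rewrite mulr_ge0 ?edge_weight_ge0 ?sqr_ge0.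
have ht0 : 0 < h / t by rewrite divr_gt0.
(* The empty and the full set correspond to the projections 0 and 1, over which the conductance does
   not range; for them the minimum of the two masses is 0. *)
have trivial_min : Num.min (\sum_(a in A) mu a) (\sum_(a in ~: A) mu a) <= 0 ->
    h / t * Num.min (\sum_(a in A) mu a) (\sum_(a in ~: A) mu a) <=
    energy (fun a => (a \in A)%:R).
  move=> min0; apply: le_trans energy_ge0.
  by rewrite pmulr_rle0.
have [A0|[a aA]] := set_0Vmem A.
  by apply: trivial_min; rewrite A0 big_set0 ge_min lexx.
have [A0|[b bA]] := set_0Vmem (~: A).
  by apply: trivial_min; rewrite A0 big_set0 ge_min lexx orbT.
have P0 := udiag_set_neq0 U_unitary aA.
have P1 : udiag U (fun a => (a \in A)%:R) != 1%:M.
  by apply: (udiag_set_neq1 (b := b)) => //; rewrite inE in bA.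
have Pp := projection_udiag_set A U_unitary.
have cond := conductance_le a0 D_posdef D_tr1 L_dirichlet Pp P0 P1.
have upper := dirichlet_le_energy D_posdef L_dirichlet
  (fun a => (a \in A)%:R) U_unitary.
have compl : \sum_(a in ~: A) mu a = 1 - \sum_(a in A) mu a.
  rewrite -mu_sum [X in _ = X - _](bigID (mem A)) /= addrC addrK.
  by apply: eq_bigl => k; rewrite inE.
rewrite compl mulrAC ler_pdivrMr // [X in _ <= X]mulrC.
apply: le_trans upper; apply: le_trans cond.
by rewrite Re_state_udiag_set.
Qed.

Lemma oscillation_le (x : 'I_n -> R) a b :
  complex.Re (kms D (udiag U x) (L (udiag U x))) <= 1 ->
  `|x a - x b| <= 2 * t / (s * h) * Num.sqrt (l / s).
Proof.
move=> x1; have ht0 : 0 < h / t by rewrite divr_gt0.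
have ls0 : 0 < l / s by rewrite divr_gt0 // kms_mapnorm_gt0.
have mu_ge0 k : 0 <= mu k by apply: le_trans (mu_ge k); exact: ltW.
(* Cut constant [h / t], degree constant [l / s]. *)
have [c cheeger] := cheeger_inequality (edge_weight_ge0 W U) mu_ge0 ht0 ls0
  energy_set1_le conductance_le_energy x a0.
apply: (oscillation_arith s_gt0 t_gt0 h_gt0 kms_mapnorm_gt0 _ cheeger); last first.
  exact: le_trans (dirichlet_ge_energy D_posdef a0 L_dirichlet x U_unitary) x1.
(* For [a != b] the terms of both indices occur separately in the variance, and each has mass at
   least [s]; the case [a = b] is trivial. *)
have [->|ab] := eqVneq a b.
  rewrite subrr expr0n mulr0 mulr_ge0 //; apply: sumr_ge0 => k _.
  by rewrite mulr_ge0 ?sqr_ge0.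
rewrite (bigD1 a) //= (bigD1 b) 1?eq_sym //=.
set T := \sum_(k | _) _; have T0 : 0 <= T.
  by apply: sumr_ge0 => k _; rewrite mulr_ge0 ?sqr_ge0.
have xa : s * (x a - c) ^+ 2 <= mu a * (x a - c) ^+ 2.
  by rewrite ler_wpM2r ?sqr_ge0 // mu_ge.
have xb : s * (x b - c) ^+ 2 <= mu b * (x b - c) ^+ 2.
  by rewrite ler_wpM2r ?sqr_ge0 // mu_ge.
have : s * (x a - x b) ^+ 2 <= 2 * (s * (x a - c) ^+ 2 + s * (x b - c) ^+ 2).
  rewrite -mulrDr [X in _ <= X]mulrCA ler_pM2l //.
  by have := sqr_ge0 (x a - c + (x b - c)); lra.
move: (s * _) (mu a * _) (mu b * _) xa xb => *; lra.
Qed.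

End Eigenbasis.
End Oscillation.

(** * Pairings with density matrices and comparison of the distances *)

(** Under the product coupling of [p] and [q], the difference of the means of [x] is the average of
    [x a - x b]. *)
Lemma convex_difference_le (R : numDomainType) (I : finType) (p q x : I -> R)
    (B : R) :
  (forall a, 0 <= p a) -> (forall a, 0 <= q a) ->
  \sum_a p a = 1 -> \sum_a q a = 1 ->
  (forall a b, `|x a - x b| <= B) -> `|\sum_a x a * (p a - q a)| <= B.
Proof.
move=> p0 q0 p1 q1 xB.
have -> : \sum_a x a * (p a - q a) =
    \sum_a \sum_b p a * q b * (x a - x b).
  have -> : \sum_a \sum_b p a * q b * (x a - x b) =
      \sum_a \sum_b (x a * p a) * q b - \sum_a \sum_b p a * (x b * q b).
    rewrite -sumrB; apply: eq_bigr => a _; rewrite -sumrB.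
    by apply: eq_bigr => b _; ring.
  under [X in _ = X - _]eq_bigr => a _ do rewrite -mulr_sumr q1 mulr1.
  under [X in _ = _ - X]eq_bigr => a _ do rewrite -mulr_sumr.
  rewrite -mulr_suml p1 mul1r -sumrB.
  by apply: eq_bigr => a _; rewrite mulrBr.
apply: le_trans (ler_norm_sum _ _ _) _.
have -> : B = \sum_a \sum_b p a * q b * B.
  under eq_bigr => a _ do rewrite -mulr_suml -mulr_sumr q1 mulr1.
  by rewrite -mulr_suml p1 mul1r.
apply: ler_sum => a _; apply: le_trans (ler_norm_sum _ _ _) _.
apply: ler_sum => b _; rewrite normrM ger0_norm ?mulr_ge0 //.
by rewrite ler_wpM2l ?mulr_ge0.
Qed.

Lemma sum_le_mean (R : realDomainType) (I : finType) (a b : R) (f g h : I -> R) :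
  a = \sum_i f i -> b = \sum_i g i -> b = \sum_i h i ->
  (forall i, 2 * f i <= g i + h i) -> a <= b.
Proof.
move=> -> bg bh fgh; rewrite -(ler_pM2l (ltr0Sn R 1)).
have -> : 2 * b = \sum_i (g i + h i).
  by rewrite big_split /= -bg -bh mulr_natl mulr2n.
rewrite mulr_sumr; exact: ler_sum.
Qed.

(** In the eigenbasis of [D], the state is a convex combination of diagonal entries, each at most
    the operator norm. *)
Lemma Re_state_Gamma0_le1 (R : realType) (n m : nat) (D : 'M[R[i]]_n)
    (W : 'I_m -> 'M[R[i]]_n) (X : 'M[R[i]]_n) :
  posdefmx D -> \tr D = 1 -> opnorm (Gamma0 W X) <= 1 ->
  complex.Re (state D (Gamma0 W X)) <= 1.
Proof.
move=> D_posdef D_tr1 G1; rewrite /state mxtrace_mulC {1}(posdef_udiag D_posdef).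
have V_unitary := spectral_unitarymx D.
rewrite mxtrace_udiag Re_sum.
have tr1 : \sum_a spec_val D a = 1.
  have := congr1 (@complex.Re R) D_tr1; rewrite {1}(posdef_udiag D_posdef).
  rewrite -(mul1mx (udiag _ _)) mxtrace_udiag Re_sum => /= <-.
  apply: eq_bigr => a _; rewrite mulmx1 (unitarymxP V_unitary) ReM_real mxE.
  by rewrite eqxx mulr1.
rewrite -[X in _ <= X]tr1; apply: ler_sum => a _.
rewrite ReM_real -[X in _ <= X]mulr1 ler_pM2l ?spec_val_gt0 //.
rewrite quadform_diag; apply: quadform_le_opnorm => //.
rewrite hs_unitaryl ?trmxC_unitary // /hs (bigD1 a) //= [X in _ + X]big1 => [|b ba].
  by rewrite big_ord1 mxE !eqxx cmod_real_sqr expr1n addr0.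
by rewrite big_ord1 mxE (negPf ba) cmod_real_sqr expr0n.
Qed.

(* For Hermitian X, [W_j, X]^* = - [W_(sigma j), X], so that summing
   [W_j, X] [W_j, X]^* over j also gives Gamma0(X). *)
Lemma dirichlet_le_Gamma0 (R : realType) (n m : nat) (D : 'M[R[i]]_n)
    (W : 'I_m -> 'M[R[i]]_n) (sigma : {perm 'I_m}) (X : 'M[R[i]]_n) :
  posdefmx D -> (forall j, (W j) ^t* = W (sigma j)) -> X ^t* = X ->
  \sum_j complex.Re (kms D (commutator (W j) X) (commutator (W j) X)) <=
  complex.Re (state D (Gamma0 W X)).
Proof.
move=> D_posdef W_adj X_herm; set A := fun j => commutator (W j) X.
have A_adj j : (A j) ^t* = - A (sigma j).
  by rewrite /A /commutator trC_sub !trC_mul X_herm W_adj opprB.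
have AA j : A j *m (A j) ^t* = (A (sigma j)) ^t* *m A (sigma j).
  have -> : A (sigma j) = - (A j) ^t* by rewrite A_adj opprK.
  have -> : (- (A j) ^t*) ^t* = - A j.
    by apply/matrixP => a b; rewrite !mxE rmorphN /= conjCK.
  by rewrite mulNmx mulmxN opprK.
have stateE : complex.Re (state D (Gamma0 W X)) =
    \sum_j complex.Re (state D ((A j) ^t* *m A j)).
  by rewrite /state /Gamma0 mulmx_sumr -Re_sum; congr complex.Re; exact: raddf_sum.
have stateE' : complex.Re (state D (Gamma0 W X)) =
    \sum_j complex.Re (state D (A j *m (A j) ^t*)).
  rewrite stateE [LHS](reindex_inj (@perm_inj _ sigma)).
  by apply: eq_bigr => j _; rewrite AA.
apply: (sum_le_mean (erefl _) stateE' stateE) => j.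
exact: kms_le_state.
Qed.

(** The diagonals of [D1] and [D2] in the basis given by [U] are probability vectors, and the trace
    is the difference of the means of [x] under them. *)
Lemma density_pairing_le (R : realType) (n : nat) (D1 D2 U : 'M[R[i]]_n)
    (x : 'I_n -> R) (B : R) :
  density D1 -> density D2 -> U \is unitarymx ->
  (forall a b, `|x a - x b| <= B) ->
  cmod (\tr ((D1 - D2) *m udiag U x)) <= B.
Proof.
move=> [D1_psd D1_tr] [D2_psd D2_tr] U_unitary xB.
pose p (E : 'M[R[i]]_n) a := complex.Re ((U *m E *m U ^t*) a a).
have pE E a : psdmx E -> (U *m E *m U ^t*) a a = (p E a)%:C.
  move=> E_psd; have /ger0_real E_real := psd_diag U a E_psd.
  by rewrite /p RRe_real.
have p_ge0 E a : psdmx E -> 0 <= p E a.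
  by move=> E_psd; rewrite -lecR -pE // psd_diag.
have p_sum E : \tr E = 1 -> \sum_a p E a = 1.
  move=> E_tr; rewrite /p -Re_sum -/(mxtrace _) mxtrace_mulC mulmxA.
  by rewrite unitary_trCl // mul1mx E_tr.
rewrite mxtrace_udiag.
have -> : \sum_a (x a)%:C * (U *m (D1 - D2) *m U ^t*) a a =
    (\sum_a x a * (p D1 a - p D2 a))%:C.
  rewrite rmorph_sum; apply: eq_bigr => a _.
  have subE (M N : 'M[R[i]]_n) : (M - N) a a = M a a - N a a by rewrite !mxE.
  rewrite mulmxBr mulmxBl subE (pE _ _ D1_psd) (pE _ _ D2_psd).
  by rewrite -rmorphB -rmorphM.
rewrite cmod_real; apply: convex_difference_le => //; try exact: p_sum.
  by move=> a; apply: p_ge0.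
by move=> a; apply: p_ge0.
Qed.

Theorem mainTheorem4 (R : realType) (n : nat) (hn : (2 <= n)%N)
    (Phi : R -> 'M[R[i]]_n -> 'M[R[i]]_n)
    (L : {linear 'M[R[i]]_n -> 'M[R[i]]_n})
    (D : 'M[R[i]]_n)
    (hPhi : quantum_markov_semigroup Phi)
    (hL : generates L Phi)
    (hprim : primitive Phi L)
    (hD : faithful_density D)
    (hinv : invariant_state D Phi)
    (hkms : kms_symmetric D Phi)
    (m : nat) (W : 'I_m -> 'M[R[i]]_n)
    (hWadj : exists sigma : {perm 'I_m}, forall j, (W j) ^t* = W (sigma j))
    (hW : forall X Y : 'M[R[i]]_n,
      kms D X (L Y)
      = \sum_(j < m) kms D (commutator (W j) X) (commutator (W j) Y)) :
  (forall D1 D2 : 'M[R[i]]_n, density D1 -> density D2 ->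
     (dist_Gamma0 W D1 D2 <= dist_L D L D1 D2)%E) /\
  (diam (dist_Gamma0 W) <= diam (dist_L D L))%E /\
  (diam (dist_L D L) <=
     (2 * largest_eigenvalue D / (smallest_eigenvalue D * conductance D L)
      * Num.sqrt (kms_mapnorm D L / smallest_eigenvalue D))%:E)%E.
Proof.
have [D_posdef D_tr1] := hD; have [_ L_kernel] := hprim.
have [sigma W_adj] := hWadj.
have kerL X : L X = 0 -> exists c : R[i], X = c%:M.
  by move=> LX0; apply/L_kernel.
(* Every [X] admissible for Connes' distance is admissible for [dist_L], because
   [<X, L X> <= rho(Gamma0(X)) <= 1]. *)
have dist_le D1 D2 : (dist_Gamma0 W D1 D2 <= dist_L D L D1 D2)%E.
  apply: ub_ereal_sup => _ [X [X_herm X_le1] <-]; apply: ereal_sup_ubound.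
  exists X => //; split=> //; rewrite (Re_dirichlet hW).
  apply: le_trans (dirichlet_le_Gamma0 D_posdef W_adj X_herm) _.
  exact: Re_state_Gamma0_le1.
split=> [D1 D2 _ _|]; first exact: dist_le.
split.
  apply: ub_ereal_sup => _ [D1 D1_density [D2 D2_density <-]].
  apply: le_trans (dist_le D1 D2) _; apply: ereal_sup_ubound.
  by exists D1 => //; exists D2.
apply: ub_ereal_sup => _ [D1 D1_density [D2 D2_density <-]].
apply: ub_ereal_sup => _ [X [X_herm X_le1] <-]; rewrite lee_fin.
(* The indices 1 and 0, available because [n >= 2]. *)
have a10 : Ordinal hn != Ordinal (ltnW hn) by [].
have := hermitian_udiag X_herm; have := spectral_unitarymx X.
move: (spectralmx X) (fun a => _) => U x U_unitary X_diag.
rewrite X_diag; apply: density_pairing_le => // a b.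
apply: (oscillation_le a10 D_posdef D_tr1 hW kerL U_unitary).
by rewrite -X_diag.
Qed.
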